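(* Let $k\ge1$ and consider the nonlinear Schrödinger equation $iu_t+u_{xx}+f(|u|^2)u=0$ on $I=[a,b]$ with periodic boundary conditions. Assume that the exact solution $u$ and the nonlinear term $f(|u|^2)$ are sufficiently smooth with bounded derivatives for any time $t\in(0,T_e]$. Let the mesh be uniform of size $h$ with $N$ cells, and let the real flux parameters $\alpha_1,\beta_1,\beta_2$ satisfy one of the following existence conditions for the projection $P_h^\star$: (a) $\alpha_1^2+\beta_1\beta_2=\frac14$, ($\beta_1\ne0$ or $\beta_2\neq0$), and $\beta_1-\frac{k^2}{h}+\beta_2\frac{k^2(k^2-1)}{h^2}\ne0$; or (b) $\alpha_1^2+\beta_1\beta_2\neq\frac14$ and, with $\Gamma=\beta_1+\frac{k^2(k^2-1)}{h^2}\beta_2-\frac{2k^2}{h}(\alpha_1^2+\beta_1\beta_2+\frac14)$ and $\Lambda=-\frac{2k}{h}(\alpha_1^2+\beta_1\beta_2-\frac14)$, either $|\Gamma|>|\Lambda|$; or $|\Gamma|=|\Lambda|$, $N$ is odd, and $\Gamma=-\Lambda$ if $k$ is odd, $\Gamma=\Lambda$ if $k$ is even; or $|\Gamma|<|\Lambda|$ and $(-1)^{(k+1)N}\big(\frac{\Gamma}{\Lambda}+\sqrt{(\frac{\Gamma}{\Lambda})^2-1}\big)^N\ne1$. Furthermore, assume that $\epsilon_h=u-P_h^\star u$ has at least first order convergence rate (in $h$) in the $L^2(I)$ and $L^\infty(I)$ norms. Let $u_h\in V_h^k$ be the numerical solution of the ultra-weak DG scheme described in the context, with these flux parameters. Then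 $$\|u-u_h\|_{L^2(I)}\le C_\star\left(\|(u-u_h)|_{t=0}\|_{L^2(I)}+\|(\epsilon_h)_t\|_{L^2(I)}+\|\epsilon_h\|_{L^2(I)}\right),$$ where $C_\star$ depends on $k$, $\|f\|_{W^{2,\infty}}$, $u$ and the final time $T_e$, but not on $h$. In other words, the error of the DG scheme has the same order of convergence as the error of the projection $P_h^\star$ for the given parameter choice, if the numerical initial condition is chosen sufficiently accurate.
   Context: $f$ is a given real-valued function; $u$ is complex valued. Mesh: $a=x_{1/2}<\dots<x_{N+1/2}=b$, $I_j=(x_{j-1/2},x_{j+1/2})$, uniform with $h=(b-a)/N$. $V_h^k$ is the space of (complex-valued) functions on $I$ whose restriction to each $I_j$ is a polynomial of degree at most $k$. At an interface, $v^\pm$ denote the limits from the right ($+$) and left ($-$) cells, with periodic identification of $x_{1/2}$ and $x_{N+1/2}$; $[v]=v^+-v^-$, $\{v\}=\frac12(v^++v^-)$; the same notation is used for the piecewise derivative $v_x$. DG scheme: $u_h=u_h(t)\in V_h^k$ satisfies, for all $v_h\in V_h^k$ and all $j=1,\dots,N$, $$i\int_{I_j}(u_h)_t v_h\,dx+\int_{I_j}u_h(v_h)_{xx}\,dx-\hat u_h (v_h)_x^-|_{j+\frac12}+\hat u_h (v_h)_x^+|_{j-\frac12}+\widetilde{(u_h)_x}\,v_h^-|_{j+\frac12}-\widetilde{(u_h)_x}\,v_h^+|_{j-\frac12}+\int_{I_j}f(|u_h|^2)u_hv_h\,dx=0,$$ with periodic boundary conditions and numerical fluxes $$\widetilde{(u_h)_x}=\{(u_h)_x\}+\alpha_1[(u_h)_x]+\beta_1[u_h],\qquad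 \hat u_h=\{u_h\}-\alpha_1[u_h]+\beta_2[(u_h)_x],\qquad \alpha_1,\beta_1,\beta_2\in\mathbb{R}.$$ Projection $P_h^\star$ (with the same $\alpha_1,\beta_1,\beta_2$): for a periodic function $u$, $P_h^\star u$ is the unique $w\in V_h^k$ satisfying, for all $j=1,\dots,N$, (i) $\int_{I_j}w\,v_h\,dx=\int_{I_j}u\,v_h\,dx$ for all $v_h\in P^{k-2}(I_j)$ (void if $k=1$); (ii) $\{w\}-\alpha_1[w]+\beta_2[w_x]=u$ at $x_{j+1/2}$; (iii) $\{w_x\}+\alpha_1[w_x]+\beta_1[w]=u_x$ at $x_{j+1/2}$. It is applied to $u(\cdot,t)$ at each time $t$. ''At least first order convergence rate'' means $\|\epsilon_h\|_{L^p(I)}\le C_1h$ for $p=2,\infty$, with $C_1$ independent of $h$ (but possibly depending on $u$). The estimate is for times $t\in(0,T_e]$; the norms of $\epsilon_h$ and $(\epsilon_h)_t$ on the right-hand side are understood as maxima over $t\in[0,T_e]$. For a negative argument the square root in (b) is $i\sqrt{1-(\Gamma/\Lambda)^2}$. *)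

(* Defs.v *)
From Stdlib Require Import Reals Lra Lia Psatz.
From Coquelicot Require Import Coquelicot.

Open Scope R_scope.

(** * Calculus for complex-valued functions of a real variable *)

Definition Dx (g : R -> C) (x : R) : C :=
  iota (fun l : C_R_CompleteNormedModule =>
          is_derive (V := C_R_NormedModule) g x l).

(** Derivative in time relative to the closed interval [0, T]: two-sided for
    0 < t < T, one-sided at 0 and at T. *)
Definition is_dt (T : R) (g : R -> C) (t : R) (l : C) : Prop :=
  filterdiff (K := R_AbsRing) (U := R_NormedModule) (V := C_R_NormedModule) g
    (within (fun s => 0 <= s <= T) (locally t)) (fun s : R => scal s l).

Definition Dt (T : R) (g : R -> C) (t : R) : C :=
  iota (fun l : C_R_CompleteNormedModule => is_dt T g t l).

Definition CInt (g : R -> C) (x y : R) : C :=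
  RInt (V := C_R_CompleteNormedModule) g x y.

(** All mixed partial derivatives up to total order m exist and are bounded
    on [0, T] x R; [D i j] is the derivative of order i in time, j in space. *)
Definition smooth_bounded (m : nat) (T : R) (u : R -> R -> C) : Prop :=
  exists D : nat -> nat -> R -> R -> C,
    (forall t x, 0 <= t <= T -> D 0%nat 0%nat t x = u t x) /\
    (forall i j t x, (i + j < m)%nat -> 0 <= t <= T ->
       is_dt T (fun s => D i j s x) t (D (S i) j t x) /\
       is_derive (V := C_R_NormedModule) (D i j t) x (D i (S j) t x)) /\
    (exists B : R, forall i j t x, (i + j <= m)%nat -> 0 <= t <= T ->
       Cmod (D i j t x) <= B).

(** ‖f‖_{W^{2,oo}} <= M on [0, K] (on [0, +oo) if K = +oo). *)
Definition W2inf_le (K : Rbar) (f : R -> R) (M : R) : Prop :=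
  forall s, 0 <= s -> Rbar_le s K ->
  forall i, (i <= 2)%nat -> ex_derive_n f i s /\ Rabs (Derive_n f i s) <= M.

Definition nls_solution (T : R) (f : R -> R) (u : R -> R -> C) : Prop :=
  forall t x, 0 <= t <= T ->
    (Ci * Dt T (fun s => u s x) t + Dx (Dx (u t)) x
     + RtoC (f (Cmod (u t x) ^ 2)%R) * u t x = 0)%C.

(** * Mesh and discontinuous piecewise polynomials

    Cells are numbered from 0: cell j < N is the interval between [node j] and
    [node (S j)], and node i is the interface x_{i+1/2}.  A piecewise function
    is given cell by cell, so that it has two values at every interface. *)

Definition hmesh (a b : R) (N : nat) : R := (b - a) / INR N.
Definition node (a b : R) (N i : nat) : R := a + INR i * hmesh a b N.

Definition bfun := nat -> R -> C.

Definition Dxb (w : bfun) : bfun := fun j => Dx (w j).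

Definition pval (k : nat) (c : nat -> C) (x : R) : C :=
  sum_n (G := C_AbelianMonoid) (fun m => (c m * RtoC (x ^ m))%C) k.

(** Elements of V_h^k: [v j m] is the coefficient of x^m on cell j; only the
    coefficients with j < N and m <= k are meaningful. *)
Definition Vh := nat -> nat -> C.
Definition ev (k : nat) (v : Vh) : bfun := fun j => pval k (v j).

(** Traces at interface i (0 <= i <= N), interfaces 0 and N being identified. *)
Definition trp (a b : R) (N : nat) (w : bfun) (i : nat) : C :=
  let j := Nat.modulo i N in w j (node a b N j).
Definition trm (a b : R) (N : nat) (w : bfun) (i : nat) : C :=
  let j := Nat.modulo (i + N - 1) N in w j (node a b N (S j)).

Definition jump (a b : R) (N : nat) (w : bfun) (i : nat) : C :=
  (trp a b N w i - trm a b N w i)%C.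
Definition avg (a b : R) (N : nat) (w : bfun) (i : nat) : C :=
  (RtoC (1 / 2) * (trp a b N w i + trm a b N w i))%C.

Definition flux_u (a b : R) (N : nat) (al1 be2 : R) (w : bfun) (i : nat) : C :=
  (avg a b N w i - RtoC al1 * jump a b N w i
   + RtoC be2 * jump a b N (Dxb w) i)%C.
Definition flux_ux (a b : R) (N : nat) (al1 be1 : R) (w : bfun) (i : nat) : C :=
  (avg a b N (Dxb w) i + RtoC al1 * jump a b N (Dxb w) i
   + RtoC be1 * jump a b N w i)%C.

(** * Norms on I, with values in [Rbar] where a supremum may be infinite *)

Definition L2norm (a b : R) (N : nat) (g : bfun) : R :=
  sqrt (sum_n (fun j => RInt (fun x => Cmod (g j x) ^ 2)
                          (node a b N j) (node a b N (S j))) (N - 1)).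

Definition Linfnorm (a b : R) (N : nat) (g : bfun) : Rbar :=
  Lub_Rbar (fun y => exists j x, (j < N)%nat /\
    node a b N j <= x <= node a b N (S j) /\ y = Cmod (g j x)).

Definition sup_time (T : R) (g : R -> R) : Rbar :=
  Lub_Rbar (fun y => exists t, 0 <= t <= T /\ y = g t).

(** * The ultra-weak DG scheme *)

Definition dg_solution (a b T : R) (f : R -> R) (k N : nat)
    (al1 be1 be2 : R) (uh : R -> Vh) : Prop :=
  (forall t j m, 0 <= t <= T -> (j < N)%nat -> (m <= k)%nat ->
     exists l, is_dt T (fun s => uh s j m) t l) /\
  (forall t, 0 <= t <= T -> forall (c : nat -> C) (j : nat), (j < N)%nat ->
     let w := ev k (uh t) in
     let v := pval k c in
     let xl := node a b N j in
     let xr := node a b N (S j) in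
     (Ci * CInt (fun x => Dt T (fun s => ev k (uh s) j x) t * v x) xl xr
      + CInt (fun x => w j x * Dx (Dx v) x) xl xr
      - flux_u a b N al1 be2 w (S j) * Dx v xr
      + flux_u a b N al1 be2 w j * Dx v xl
      + flux_ux a b N al1 be1 w (S j) * v xr
      - flux_ux a b N al1 be1 w j * v xl
      + CInt (fun x => RtoC (f (Cmod (w j x) ^ 2)%R) * w j x * v x) xl xr = 0)%C).

(** * The projection and its existence conditions *)

Definition proj_conditions (a b : R) (k N : nat) (al1 be1 be2 : R)
    (u : R -> C) (w : bfun) : Prop :=
  forall j, (j < N)%nat ->
    ((2 <= k)%nat -> forall c : nat -> C,
       CInt (fun x => w j x * pval (k - 2) c x)%C
            (node a b N j) (node a b N (S j))
       = CInt (fun x => u x * pval (k - 2) c x)%C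
            (node a b N j) (node a b N (S j))) /\
    flux_u a b N al1 be2 w (S j) = u (node a b N (S j)) /\
    flux_ux a b N al1 be1 w (S j) = Dx u (node a b N (S j)).

(** w is the unique element of V_h^k, as a function on the cells, satisfying
    the projection conditions. *)
Definition is_Pstar (a b : R) (k N : nat) (al1 be1 be2 : R)
    (u : R -> C) (w : Vh) : Prop :=
  proj_conditions a b k N al1 be1 be2 u (ev k w) /\
  forall w' : Vh, proj_conditions a b k N al1 be1 be2 u (ev k w') ->
    forall j x, (j < N)%nat -> node a b N j <= x <= node a b N (S j) ->
      ev k w' j x = ev k w j x.

Definition Gam (k : nat) (h al1 be1 be2 : R) : R :=
  be1 + INR k ^ 2 * (INR k ^ 2 - 1) / h ^ 2 * be2
  - 2 * INR k ^ 2 / h * (al1 ^ 2 + be1 * be2 + 1 / 4).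
Definition Lam (k : nat) (h al1 be1 be2 : R) : R :=
  - (2 * INR k / h) * (al1 ^ 2 + be1 * be2 - 1 / 4).

Definition cond_a (k : nat) (h al1 be1 be2 : R) : Prop :=
  al1 ^ 2 + be1 * be2 = 1 / 4 /\
  (be1 <> 0 \/ be2 <> 0) /\
  be1 - INR k ^ 2 / h + be2 * (INR k ^ 2 * (INR k ^ 2 - 1) / h ^ 2) <> 0.

(** In the last case (q, sqrt (1 - q^2)) is the complex number
    q + i sqrt (1 - q^2). *)
Definition cond_b (k N : nat) (h al1 be1 be2 : R) : Prop :=
  let G := Gam k h al1 be1 be2 in
  let L := Lam k h al1 be1 be2 in
  let q := G / L in
  al1 ^ 2 + be1 * be2 <> 1 / 4 /\
  (Rabs G > Rabs L \/
   (Rabs G = Rabs L /\ Nat.Odd N /\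
    (Nat.Odd k -> G = - L) /\ (Nat.Even k -> G = L)) \/
   (Rabs G < Rabs L /\
    (Cpow (RtoC (-1)) ((k + 1) * N)%nat * Cpow (q, sqrt (1 - q ^ 2)%R) N)%C
      <> RtoC 1)).

(* Main.v *)
(* Test the error equation with the conjugate of e = P_h^* u - u_h.  After
   integration by parts the DG form evaluated at (e, conj e) is a sum of real
   interface contributions, so the imaginary part of the equation leaves
   d/dt |e|^2 against (eps_h)_t and the nonlinear term.  The latter is globally
   Lipschitz at the bounded function u without any a priori bound on u_h: where
   u_h is large, |u - u_h| >= 1 and boundedness of f suffices.  Gronwall concludes.
   That P_h^* u is differentiable in time follows from its uniqueness, which makes
   its coefficients fixed linear combinations of moments and traces of u. *)
Require Import Defs.
From Stdlib Require Import Reals.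
From Coquelicot Require Import Coquelicot.
From Stdlib Require Import Lra Lia Psatz List FunctionalExtensionality Classical.
(* [Defs.Dx] would otherwise be shadowed by [Rderiv.Dx]. *)
Import Defs.
Open Scope R_scope.

(** * Complex-valued functions of a real variable *)

(** What makes the estimate free of inverse powers of h is the shape of the projection. Its fluxes
    are the traces of u and u_x, its moments up to degree k-2 are those of u, and the second
    derivative of a test function of degree k has degree at most k-2. So the space part of the
    scheme treats the projection as if it were u itself and returns the integral of u_xx against the
    test function. The projection error survives only in the time derivative and in the nonlinear
    term, where it is measured in L2.

    The constant has to be fixed before f, the mesh and the flux parameters. It is therefore built
    from T, M and a bound B for u alone: a Lipschitz-type constant L of the nonlinear term and a
    Gronwall factor X.

    Time lives on the closed interval [0, T], with one-sided derivatives at its ends, while the real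
    mean value theorem and the differentiation rules work with two-sided ones. Functions of time are
    extended by their tangent lines outside [0, T], which changes nothing inside. *)

Lemma C_eq (z w : C) : Re z = Re w -> Im z = Im w -> z = w.
Proof. destruct z, w; simpl; intros; subst; reflexivity. Qed.

Ltac Calg := apply C_eq; unfold Re, Im; simpl; ring.

Lemma norm_C_R (z : C_R_NormedModule) : norm z = Cmod z.
Proof.
destruct z as [p q]. change (sqrt (Rabs p ^ 2 + Rabs q ^ 2) = sqrt (p ^ 2 + q ^ 2)).
now rewrite !pow2_abs.
Qed.

Lemma im_le_Cmod (z : C) : Rabs (Im z) <= Cmod z.
Proof. eapply Rle_trans; [apply Rmax_r|apply Rmax_Cmod]. Qed.

Lemma Cmod_le_Re_Im (z : C) : Cmod z <= Rabs (Re z) + Rabs (Im z).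
Proof.
rewrite <- (Rabs_pos_eq (Cmod z)) by apply Cmod_ge_0.
rewrite <- (Rabs_pos_eq (Rabs (Re z) + Rabs (Im z))).
2:{ apply Rplus_le_le_0_compat; apply Rabs_pos. }
apply Rsqr_le_abs_0. unfold Rsqr.
generalize (Cmod2_alt z). rewrite <- (pow2_abs (Re z)), <- (pow2_abs (Im z)).
generalize (Rabs_pos (Re z)) (Rabs_pos (Im z)). nra.
Qed.

(** Carries uniqueness, the product rule and the mean value bounds over from the reals. In the
    converse each component receives half of [eps], because the modulus is at most the sum of the
    absolute values of the two parts. *)
Lemma is_derive_C_iff (g : R -> C) (x : R) (l : C) :
  is_derive (V := C_R_NormedModule) g x l <->
  is_derive (fun y => Re (g y)) x (Re l) /\ is_derive (fun y => Im (g y)) x (Im l).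
Proof.
split.
- intros [_ H]. split; (split; [apply is_linear_scal_l|]);
  intros y Hy eps; specialize (H y Hy eps);
  (eapply filter_imp; [|exact H]); intros z Hz;
  cbv beta in Hz; rewrite norm_C_R in Hz;
  (eapply Rle_trans; [|exact Hz]).
  + exact (re_le_Cmod (minus (minus (g z) (g y)) (scal (minus z y) l) : C_R_NormedModule)).
  + exact (im_le_Cmod (minus (minus (g z) (g y)) (scal (minus z y) l) : C_R_NormedModule)).
- intros [[_ H1] [_ H2]]. split; [apply is_linear_scal_l|].
  intros y Hy eps.
  assert (He : 0 < eps / 2) by (destruct eps; simpl; lra).
  specialize (H1 y Hy (mkposreal _ He)). specialize (H2 y Hy (mkposreal _ He)).
  generalize (filter_and _ _ H1 H2). apply filter_imp. intros z [A B].
  rewrite norm_C_R. eapply Rle_trans; [apply Cmod_le_Re_Im|].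
  eapply Rle_trans; [apply (Rplus_le_compat _ _ _ _ A B)|].
  simpl; right; field.
Qed.

Lemma is_derive_C_unique (g : R -> C) (x : R) (l l' : C) :
  is_derive (V := C_R_NormedModule) g x l ->
  is_derive (V := C_R_NormedModule) g x l' -> l = l'.
Proof.
intros H H'. apply is_derive_C_iff in H. apply is_derive_C_iff in H'.
destruct H as [H1 H2], H' as [H1' H2'].
apply is_derive_unique in H1. apply is_derive_unique in H2.
apply is_derive_unique in H1'. apply is_derive_unique in H2'.
apply C_eq; congruence.
Qed.

Lemma Dx_unique (g : R -> C) (x : R) (l : C) :
  is_derive (V := C_R_NormedModule) g x l -> Dx g x = l.
Proof.
intros H. unfold Dx.
apply (iota_unique (V := C_R_CompleteNormedModule)); [|exact H].
intros y Hy. exact (is_derive_C_unique _ _ _ _ Hy H).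
Qed.

Lemma is_derive_C_mult (g h : R -> C) (x : R) (dg dh : C) :
  is_derive (V := C_R_NormedModule) g x dg ->
  is_derive (V := C_R_NormedModule) h x dh ->
  is_derive (V := C_R_NormedModule) (fun y => (g y * h y)%C) x (dg * h x + g x * dh)%C.
Proof.
rewrite !is_derive_C_iff. intros [A B] [A' B']. split.
- apply is_derive_ext with (fun y => minus (mult (Re (g y)) (Re (h y))) (mult (Im (g y)) (Im (h y)))); [reflexivity|].
  evar_last. { apply (is_derive_minus (V := R_NormedModule)); apply (is_derive_mult (K := R_AbsRing)); eauto; intros; apply Rmult_comm. }
  unfold minus, plus, opp, mult, Re, Im; simpl; ring.
- apply is_derive_ext with (fun y => plus (mult (Re (g y)) (Im (h y))) (mult (Im (g y)) (Re (h y)))); [reflexivity|].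
  evar_last. { apply (is_derive_plus (V := R_NormedModule)); apply (is_derive_mult (K := R_AbsRing)); eauto; intros; apply Rmult_comm. }
  unfold minus, plus, opp, mult, Re, Im; simpl; ring.
Qed.

Lemma is_derive_C_minus (g h : R -> C) (x : R) (dg dh : C) :
  is_derive (V := C_R_NormedModule) g x dg ->
  is_derive (V := C_R_NormedModule) h x dh ->
  is_derive (V := C_R_NormedModule) (fun y => (g y - h y)%C) x (dg - dh)%C.
Proof. intros A B. exact (is_derive_minus (V := C_R_NormedModule) _ _ _ _ _ A B). Qed.

(** Stated by components so that real integrability and the real fundamental theorem apply directly.
    Continuity at the end points is two-sided, which suits polynomials and [u], all defined on the
    whole line. *)
Definition ccont (g : R -> C) (l r : R) : Prop :=
  forall x, l <= x <= r ->
    continuous (fun y => Re (g y)) x /\ continuous (fun y => Im (g y)) x.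

Lemma ccont_derive (g g' : R -> C) (l r : R) :
  (forall x, l <= x <= r -> is_derive (V := C_R_NormedModule) g x (g' x)) -> ccont g l r.
Proof.
intros H x Hx. destruct (proj1 (is_derive_C_iff _ _ _) (H x Hx)) as [A B].
split; apply (ex_derive_continuous (K := R_AbsRing) (V := R_NormedModule)); eexists; eauto.
Qed.

Lemma ccont_plus (g h : R -> C) (l r : R) :
  ccont g l r -> ccont h l r -> ccont (fun x => (g x + h x)%C) l r.
Proof.
intros A B x Hx. destruct (A x Hx), (B x Hx).
split; apply (continuous_plus (V := R_NormedModule)); auto.
Qed.

Lemma ccont_opp (g : R -> C) (l r : R) :
  ccont g l r -> ccont (fun x => (- g x)%C) l r.
Proof. intros A x Hx. destruct (A x Hx). split; apply (continuous_opp (V := R_NormedModule)); auto. Qed.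

Lemma ccont_minus (g h : R -> C) (l r : R) :
  ccont g l r -> ccont h l r -> ccont (fun x => (g x - h x)%C) l r.
Proof. intros A B. apply ccont_plus; auto. now apply ccont_opp. Qed.

Lemma ccont_mult (g h : R -> C) (l r : R) :
  ccont g l r -> ccont h l r -> ccont (fun x => (g x * h x)%C) l r.
Proof.
intros A B x Hx. destruct (A x Hx), (B x Hx). split.
- apply (continuous_minus (V := R_NormedModule)); apply (continuous_mult (K := R_AbsRing)); auto.
- apply (continuous_plus (V := R_NormedModule)); apply (continuous_mult (K := R_AbsRing)); auto.
Qed.

Lemma ccont_conj (g : R -> C) (l r : R) :
  ccont g l r -> ccont (fun x => Cconj (g x)) l r.
Proof. intros A x Hx. destruct (A x Hx). split; [|apply (continuous_opp (V := R_NormedModule))]; auto. Qed.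

Lemma ccont_const (c : C) (l r : R) : ccont (fun _ => c) l r.
Proof. intros x Hx. split; apply continuous_const. Qed.

Lemma ccont_RtoC (g : R -> R) (l r : R) :
  (forall x, l <= x <= r -> continuous g x) -> ccont (fun x => RtoC (g x)) l r.
Proof. intros H x Hx. split; [exact (H x Hx)|apply continuous_const]. Qed.

Lemma continuous_Cmod2 (g : R -> C) (l r : R) :
  ccont g l r -> forall x, l <= x <= r -> continuous (fun y => Cmod (g y) ^ 2) x.
Proof.
intros A x Hx. destruct (A x Hx) as [B D].
apply continuous_ext with (fun y => plus (mult (Re (g y)) (Re (g y))) (mult (Im (g y)) (Im (g y)))).
{ intros y. rewrite Cmod2_alt. unfold plus, mult; simpl; ring. }
apply (continuous_plus (V := R_NormedModule)); apply (continuous_mult (K := R_AbsRing)); auto.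
Qed.

(** * Integrals of complex-valued functions *)

Lemma ex_RInt_cont (g : R -> R) (l r : R) :
  l <= r -> (forall x, l <= x <= r -> continuous g x) -> ex_RInt g l r.
Proof.
intros Hlr H. apply (ex_RInt_continuous (V := R_CompleteNormedModule)).
rewrite Rmin_left, Rmax_right by lra. exact H.
Qed.

Lemma is_CInt (g : R -> C) (l r : R) : l <= r -> ccont g l r ->
  is_RInt (V := C_R_NormedModule) g l r (CInt g l r).
Proof.
intros Hlr H. unfold CInt. apply (RInt_correct (V := C_R_CompleteNormedModule)).
destruct (ex_RInt_cont (fun x => Re (g x)) l r Hlr (fun x Hx => proj1 (H x Hx))) as [p Hp].
destruct (ex_RInt_cont (fun x => Im (g x)) l r Hlr (fun x Hx => proj2 (H x Hx))) as [q Hq].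
exists (p, q). apply is_RInt_fct_extend_pair; assumption.
Qed.

Lemma is_CInt_unique (g : R -> C) (l r : R) (z : C) :
  is_RInt (V := C_R_NormedModule) g l r z -> CInt g l r = z.
Proof. apply (is_RInt_unique (V := C_R_CompleteNormedModule)). Qed.

Lemma Re_CInt (g : R -> C) (l r : R) : l <= r -> ccont g l r ->
  Re (CInt g l r) = RInt (fun x => Re (g x)) l r.
Proof.
intros Hlr H. symmetry. apply is_RInt_unique.
exact (is_RInt_fct_extend_fst (U := R_NormedModule) (V := R_NormedModule) g l r _ (is_CInt g l r Hlr H)).
Qed.

Lemma Im_CInt (g : R -> C) (l r : R) : l <= r -> ccont g l r ->
  Im (CInt g l r) = RInt (fun x => Im (g x)) l r.
Proof.
intros Hlr H. symmetry. apply is_RInt_unique.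
exact (is_RInt_fct_extend_snd (U := R_NormedModule) (V := R_NormedModule) g l r _ (is_CInt g l r Hlr H)).
Qed.

Lemma CInt_plus (g h : R -> C) (l r : R) : l <= r -> ccont g l r -> ccont h l r ->
  CInt (fun x => (g x + h x)%C) l r = (CInt g l r + CInt h l r)%C.
Proof.
intros Hlr A B. apply is_CInt_unique.
exact (is_RInt_plus (V := C_R_NormedModule) _ _ _ _ _ _ (is_CInt g l r Hlr A) (is_CInt h l r Hlr B)).
Qed.

Lemma CInt_minus (g h : R -> C) (l r : R) : l <= r -> ccont g l r -> ccont h l r ->
  CInt (fun x => (g x - h x)%C) l r = (CInt g l r - CInt h l r)%C.
Proof.
intros Hlr A B. apply is_CInt_unique.
exact (is_RInt_minus (V := C_R_NormedModule) _ _ _ _ _ _ (is_CInt g l r Hlr A) (is_CInt h l r Hlr B)).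
Qed.

Lemma CInt_ext (g h : R -> C) (l r : R) : l <= r ->
  (forall x, l <= x <= r -> g x = h x) -> CInt g l r = CInt h l r.
Proof.
intros Hlr H. apply (RInt_ext (V := C_R_CompleteNormedModule)).
rewrite Rmin_left, Rmax_right by lra. intros x Hx. apply H. lra.
Qed.

(** The integral takes values in [C] as a real normed module, whose scalars are real; a complex
    factor has to be pulled out through real and imaginary parts. *)
Lemma CInt_scal (c : C) (g : R -> C) (l r : R) : l <= r -> ccont g l r ->
  CInt (fun x => (c * g x)%C) l r = (c * CInt g l r)%C.
Proof.
intros Hlr A.
assert (A' : ccont (fun x => (c * g x)%C) l r) by (apply ccont_mult; auto; apply ccont_const).
assert (P : ex_RInt (fun x => Re (g x)) l r) by (apply ex_RInt_cont; auto; apply A).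
assert (Q : ex_RInt (fun x => Im (g x)) l r) by (apply ex_RInt_cont; auto; apply A).
apply C_eq.
- rewrite Re_CInt by auto.
  transitivity (Re c * Re (CInt g l r) - Im c * Im (CInt g l r)); [|unfold Re, Im; simpl; ring].
  rewrite Re_CInt, Im_CInt by auto.
  apply is_RInt_unique.
  apply (is_RInt_minus (V := R_NormedModule)); apply (is_RInt_scal (V := R_NormedModule)); now apply (RInt_correct (V := R_CompleteNormedModule)).
- rewrite Im_CInt by auto.
  transitivity (Re c * Im (CInt g l r) + Im c * Re (CInt g l r)); [|unfold Re, Im; simpl; ring].
  rewrite Re_CInt, Im_CInt by auto.
  apply is_RInt_unique.
  apply (is_RInt_plus (V := R_NormedModule)); apply (is_RInt_scal (V := R_NormedModule)); now apply (RInt_correct (V := R_CompleteNormedModule)).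
Qed.

Lemma CInt_0 (l r : R) : l <= r -> CInt (fun _ => RtoC 0) l r = 0%C.
Proof.
intros Hlr. transitivity (CInt (fun _ => (0 * 0)%C) l r).
{ apply CInt_ext; auto. intros. ring. }
rewrite CInt_scal; [ring|auto|apply ccont_const].
Qed.

Lemma CInt_FTC (g g' : R -> C) (l r : R) : l <= r ->
  (forall x, l <= x <= r -> is_derive (V := C_R_NormedModule) g x (g' x)) ->
  ccont g' l r -> CInt g' l r = (g r - g l)%C.
Proof.
intros Hlr D H.
assert (DD := fun x Hx => proj1 (is_derive_C_iff _ _ _) (D x Hx)).
apply C_eq.
- rewrite Re_CInt by auto. apply is_RInt_unique.
  apply (is_RInt_derive (V := R_CompleteNormedModule) (fun x => Re (g x))); rewrite Rmin_left, Rmax_right by lra; intros x Hx; [apply DD|apply H]; auto.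
- rewrite Im_CInt by auto. apply is_RInt_unique.
  apply (is_RInt_derive (V := R_CompleteNormedModule) (fun x => Im (g x))); rewrite Rmin_left, Rmax_right by lra; intros x Hx; [apply DD|apply H]; auto.
Qed.

(** * Time derivatives on a closed interval *)

Lemma is_dt_iff (T : R) (g : R -> C) (t : R) (l : C) : 0 <= t <= T ->
  (is_dt T g t l <->
   forall eps : R, 0 < eps -> exists d : R, 0 < d /\
     forall s, 0 <= s <= T -> Rabs (s - t) < d ->
       Cmod (g s - g t - RtoC (s - t) * l)%C <= eps * Rabs (s - t)).
Proof.
intros Ht. split.
- intros [_ H] eps He.
  assert (Hl : is_filter_lim (within (fun s => 0 <= s <= T) (locally t)) t).
  { intros P HP. unfold within. eapply filter_imp; [|exact HP]. auto. }
  destruct (H t Hl (mkposreal _ He)) as [d Hd].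
  exists d. split; [apply cond_pos|]. intros s Hs Hst.
  specialize (Hd s Hst Hs). rewrite norm_C_R in Hd.
  rewrite scal_R_Cmult in Hd. exact Hd.
- intros H. split; [apply (is_linear_scal_l (K := R_AbsRing) (V := C_R_NormedModule))|].
  intros x Hx eps.
  (* Since [t] lies in [0, T], every set of the restricted filter contains [t]; a limit [x] other
     than [t] would have a neighbourhood that misses it. *)
  assert (x = t).
  { apply NNPP. intros Hn.
    assert (He : 0 < Rabs (t - x)) by (apply Rabs_pos_lt; lra).
    assert (B : locally x (fun y => Rabs (y - x) < Rabs (t - x))).
    { exists (mkposreal _ He). intros y Hy. exact Hy. }
    apply Hx in B. apply locally_singleton in B; auto. lra. }
  subst x. destruct (H eps (cond_pos eps)) as [d [Hd Hd']].
  exists (mkposreal _ Hd). intros s Hs Hs'.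
  rewrite norm_C_R, scal_R_Cmult. apply Hd'; auto.
Qed.

Lemma is_dt_unique (T : R) (g : R -> C) (t : R) (l l' : C) : 0 < T -> 0 <= t <= T ->
  is_dt T g t l -> is_dt T g t l' -> l = l'.
Proof.
intros HT Ht H H'.
apply NNPP. intros Hn.
assert (Hp : 0 < Cmod (l - l')%C).
{ apply Cmod_gt_0. intros E. apply Hn. replace l with ((l - l') + l')%C by ring. rewrite E. ring. }
rewrite is_dt_iff in H, H' by auto.
set (p := Cmod (l - l')%C) in *.
destruct (H (p / 4)) as [d [Hd A]]; [lra|].
destruct (H' (p / 4)) as [d' [Hd' A']]; [lra|].
(* A step of length at most T/2 fits in [0, T] to the right of [t] if t <= T/2 and to the left
   otherwise. Along it the two derivatives differ by at most p/4 + p/4, less than their distance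
   p. *)
set (m := Rmin (Rmin d d') T / 2).
assert (Hm : 0 < m /\ m < d /\ m < d' /\ m <= T / 2).
{ unfold m. assert (0 < Rmin (Rmin d d') T) by (repeat apply Rmin_glb_lt; auto).
  generalize (Rmin_l (Rmin d d') T) (Rmin_r (Rmin d d') T) (Rmin_l d d') (Rmin_r d d'). lra. }
assert (exists s, 0 <= s <= T /\ Rabs (s - t) = m) as [s [Hs Hsm]].
{ destruct (Rle_dec t (T / 2)).
  - exists (t + m). split; [lra|]. replace (t + m - t) with m by ring. apply Rabs_pos_eq. lra.
  - exists (t - m). split; [lra|]. replace (t - m - t) with (- m) by ring. rewrite Rabs_Ropp. apply Rabs_pos_eq. lra. }
specialize (A s Hs). specialize (A' s Hs). rewrite Hsm in A, A'.
assert (Cmod (RtoC (s - t) * (l - l'))%C <= p / 4 * m + p / 4 * m).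
{ replace (RtoC (s - t) * (l - l'))%C with ((g s - g t - RtoC (s - t) * l') + - (g s - g t - RtoC (s - t) * l))%C by ring.
  eapply Rle_trans; [apply Cmod_triangle|]. rewrite Cmod_opp. apply Rplus_le_compat; [apply A'|apply A]; lra. }
rewrite Cmod_mult, Cmod_R, Hsm in H0. fold p in H0. nra.
Qed.

Lemma Dt_unique (T : R) (g : R -> C) (t : R) (l : C) : 0 < T -> 0 <= t <= T ->
  is_dt T g t l -> Dt T g t = l.
Proof.
intros HT Ht H. unfold Dt.
apply (iota_unique (V := C_R_CompleteNormedModule)); [|exact H].
intros y Hy. exact (is_dt_unique _ _ _ _ _ HT Ht Hy H).
Qed.

Lemma is_dt_ext (T : R) (g h : R -> C) (t : R) (l : C) : 0 <= t <= T ->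
  (forall s, 0 <= s <= T -> g s = h s) -> is_dt T g t l -> is_dt T h t l.
Proof.
intros Ht E. rewrite !is_dt_iff by auto. intros H eps He.
destruct (H eps He) as [d [Hd A]]. exists d. split; auto.
intros s Hs. rewrite <- !E by auto. now apply A.
Qed.

Lemma is_dt_lin (T : R) (g h : R -> C) (t : R) (c l m : C) : 0 <= t <= T ->
  is_dt T g t l -> is_dt T h t m ->
  is_dt T (fun s => (g s + c * h s)%C) t (l + c * m)%C.
Proof.
intros Ht. rewrite !is_dt_iff by auto. intros A B eps He.
assert (Hc := Cmod_ge_0 c).
destruct (A (eps / 2)) as [d [Hd A']]; [lra|].
(* Adding 1 to the modulus keeps the quotient defined when [c] is 0. *)
destruct (B (eps / 2 / (Cmod c + 1))) as [d' [Hd' B']].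
{ apply Rdiv_lt_0_compat; lra. }
exists (Rmin d d'). split; [now apply Rmin_glb_lt|]. intros s Hs Hst.
replace (g s + c * h s - (g t + c * h t) - RtoC (s - t) * (l + c * m))%C with
  ((g s - g t - RtoC (s - t) * l) + c * (h s - h t - RtoC (s - t) * m))%C by ring.
eapply Rle_trans; [apply Cmod_triangle|]. rewrite Cmod_mult.
assert (P : Cmod (g s - g t - RtoC (s - t) * l) <= eps / 2 * Rabs (s - t)).
{ apply A'; auto. eapply Rlt_le_trans; [exact Hst|apply Rmin_l]. }
assert (Q : Cmod (h s - h t - RtoC (s - t) * m) <= eps / 2 / (Cmod c + 1) * Rabs (s - t)).
{ apply B'; auto. eapply Rlt_le_trans; [exact Hst|apply Rmin_r]. }
assert (Q' : Cmod c * Cmod (h s - h t - RtoC (s - t) * m) <= eps / 2 * Rabs (s - t)).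
{ eapply Rle_trans; [apply Rmult_le_compat_l; [exact Hc|exact Q]|].
  replace (Cmod c * (eps / 2 / (Cmod c + 1) * Rabs (s - t))) with
    ((Cmod c / (Cmod c + 1)) * (eps / 2 * Rabs (s - t))) by (field; lra).
  rewrite <- (Rmult_1_l (eps / 2 * Rabs (s - t))) at 2.
  apply Rmult_le_compat_r.
  - apply Rmult_le_pos; [lra|apply Rabs_pos].
  - apply Rle_div_l; lra. }
lra.
Qed.

Lemma is_dt_const (T : R) (c : C) (t : R) : 0 <= t <= T -> is_dt T (fun _ => c) t 0.
Proof.
intros Ht. rewrite is_dt_iff by auto. intros eps He. exists 1. split; [lra|].
intros s Hs _. replace (c - c - RtoC (s - t) * 0)%C with (RtoC 0) by ring.
rewrite Cmod_0. apply Rmult_le_pos; [lra|apply Rabs_pos].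
Qed.

(** A quadratic remainder with a constant uniform in x stays quadratic after integration in x; this
    is the form in which differentiation under the integral is obtained below. *)
Lemma is_dt_quadratic (T : R) (g : R -> C) (t : R) (l : C) (K : R) : 0 <= t <= T ->
  (forall s, 0 <= s <= T -> Cmod (g s - g t - RtoC (s - t) * l)%C <= K * (s - t) ^ 2) ->
  is_dt T g t l.
Proof.
intros Ht H. apply is_dt_iff; auto. intros eps He.
assert (HK := Rabs_pos K).
exists (eps / (Rabs K + 1)). split; [apply Rdiv_lt_0_compat; lra|].
intros s Hs Hst. eapply Rle_trans; [now apply H|].
rewrite <- pow2_abs. set (r := Rabs (s - t)) in *.
assert (Hr : 0 <= r) by apply Rabs_pos.
assert (K <= Rabs K) by apply Rle_abs.
apply Rlt_div_r in Hst; [|lra].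
assert (K * r <= eps) by nra. nra.
Qed.

(** Continuation by the tangent lines at 0 and T: it turns the one-sided derivatives at the two ends
    into two-sided ones with the same values. *)
Definition affine_ext (T : R) (g g' : R -> C) (t : R) : C :=
  if Rlt_dec t 0 then (g 0 + RtoC t * g' 0)%C
  else if Rlt_dec T t then (g T + RtoC (t - T) * g' T)%C else g t.

Lemma affine_ext_eq (T : R) (g g' : R -> C) (t : R) : 0 <= t <= T -> affine_ext T g g' t = g t.
Proof.
intros Ht. unfold affine_ext.
destruct (Rlt_dec t 0); [lra|]. destruct (Rlt_dec T t); [lra|]. reflexivity.
Qed.

Lemma is_derive_affine_ext (T : R) (g g' : R -> C) : 0 < T ->
  (forall t, 0 <= t <= T -> is_dt T g t (g' t)) ->
  forall t, 0 <= t <= T -> is_derive (V := C_R_NormedModule) (affine_ext T g g') t (g' t).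
Proof.
intros HT H t Ht. set (G := affine_ext T g g').
assert (EG : forall t, 0 <= t <= T -> G t = g t) by (intros; now apply affine_ext_eq).
split; [apply (is_linear_scal_l (K := R_AbsRing) (V := C_R_NormedModule))|].
intros x Hx eps.
assert (t = x) by exact (is_filter_lim_locally_unique (V := R_NormedModule) t x Hx). subst x.
destruct (proj1 (is_dt_iff T g t (g' t) Ht) (H t Ht) eps (cond_pos eps)) as [d [Hd A]].
(* For an interior [t] these radii keep [s] inside [0, T]. So [s] leaves the interval only when [t]
   is the end point that it crosses, and there the extension is affine and the remainder is exactly
   0. *)
set (d0 := if Req_EM_T t 0 then d else t). set (d1 := if Req_EM_T t T then d else T - t).
assert (Hd0 : 0 < Rmin d (Rmin d0 d1)).
{ unfold d0, d1. destruct (Req_EM_T t 0), (Req_EM_T t T); repeat apply Rmin_glb_lt; lra. }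
exists (mkposreal _ Hd0). intros s Hs.
change (Rabs (s - t) < Rmin d (Rmin d0 d1)) in Hs.
assert (Rabs (s - t) < d /\ Rabs (s - t) < d0 /\ Rabs (s - t) < d1) as [S [S0 S1]].
{ generalize (Rmin_l d (Rmin d0 d1)) (Rmin_r d (Rmin d0 d1)) (Rmin_l d0 d1) (Rmin_r d0 d1). lra. }
rewrite norm_C_R, scal_R_Cmult.
change (norm (minus s t)) with (Rabs (s - t)).
change (Cmod (G s - G t - RtoC (s - t) * g' t)%C <= eps * Rabs (s - t)).
assert (Hpos : 0 <= eps * Rabs (s - t)) by (apply Rmult_le_pos; [left; apply cond_pos|apply Rabs_pos]).
rewrite (EG t Ht). apply Rabs_def2 in S0. apply Rabs_def2 in S1.
unfold d0 in S0. unfold d1 in S1.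
destruct (Rlt_dec s 0) as [Hs0|Hs0]; [|destruct (Rlt_dec T s) as [HsT|HsT]].
- destruct (Req_EM_T t 0) as [->|]; [|lra].
  unfold G, affine_ext. destruct (Rlt_dec s 0); [|lra].
  match goal with |- Cmod ?z <= _ => replace z with (RtoC 0) end.
  + now rewrite Cmod_0.
  + rewrite Rminus_0_r. ring.
- destruct (Req_EM_T t T) as [->|]; [|lra].
  unfold G, affine_ext. destruct (Rlt_dec s 0); [lra|]. destruct (Rlt_dec T s); [|lra].
  match goal with |- Cmod ?z <= _ => replace z with (RtoC 0) end.
  + now rewrite Cmod_0.
  + ring.
- rewrite EG by lra. apply A; auto. lra.
Qed.

(** The mean value theorem fails for complex values, so it is applied to the real and the imaginary
    part of the extension, each with bound [B]; hence the factor 2. *)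
Lemma is_dt_bounded_variation (T : R) (g g' : R -> C) (B : R) : 0 < T ->
  (forall t, 0 <= t <= T -> is_dt T g t (g' t)) ->
  forall s t, 0 <= s <= T -> 0 <= t <= T ->
  (forall r, Rmin s t <= r <= Rmax s t -> Cmod (g' r) <= B) ->
  Cmod (g s - g t)%C <= 2 * B * Rabs (s - t).
Proof.
intros HT H s t Hs Ht HB.
set (G := affine_ext T g g').
assert (EG : forall t, 0 <= t <= T -> G t = g t) by (intros; now apply affine_ext_eq).
assert (DG := is_derive_affine_ext T g g' HT H). fold G in DG.
rewrite <- !EG by auto.
assert (Hr : forall r, Rmin t s <= r <= Rmax t s -> 0 <= r <= T).
{ intros r. unfold Rmin, Rmax. destruct (Rle_dec t s); lra. }
assert (DG' := fun r Hr => proj1 (is_derive_C_iff _ _ _) (DG r Hr)).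
assert (P : forall p : C -> R, (forall z, Rabs (p z) <= Cmod z) ->
  (forall r, 0 <= r <= T -> is_derive (fun y => p (G y)) r (p (g' r))) ->
  Rabs (p (G s) - p (G t)) <= B * Rabs (s - t)).
{ intros p Hp Hd.
  destruct (MVT_gen (fun y => p (G y)) t s (fun r => p (g' r))) as [c [Hc Ec]].
  - intros r R. apply Hd, Hr. lra.
  - intros r R. apply derivable_continuous_pt, ex_derive_Reals_0. eexists. apply Hd, Hr, R.
  - rewrite Ec, Rabs_mult. apply Rmult_le_compat_r; [apply Rabs_pos|].
    eapply Rle_trans; [apply Hp|apply HB].
    now rewrite Rmin_comm, Rmax_comm. }
eapply Rle_trans; [apply Cmod_le_Re_Im|].
assert (P1 := P Re re_le_Cmod (fun r Hr => proj1 (DG' r Hr))).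
assert (P2 := P Im im_le_Cmod (fun r Hr => proj2 (DG' r Hr))).
change (Re (G s - G t)%C) with (Re (G s) - Re (G t)).
change (Im (G s - G t)%C) with (Im (G s) - Im (G t)).
lra.
Qed.

(** Two uses of the previous bound: on [g'], then on [g] minus its linear part at [t], whose
    derivative at [r] is [g' r - g' t]. Each costs a factor 2, which gives 4. *)
Lemma is_dt_taylor (T : R) (g g' g'' : R -> C) (B : R) : 0 < T ->
  (forall t, 0 <= t <= T -> is_dt T g t (g' t)) ->
  (forall t, 0 <= t <= T -> is_dt T g' t (g'' t)) ->
  (forall t, 0 <= t <= T -> Cmod (g'' t) <= B) ->
  forall s t, 0 <= s <= T -> 0 <= t <= T ->
  Cmod (g s - g t - RtoC (s - t) * g' t)%C <= 4 * B * (s - t) ^ 2.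
Proof.
intros HT H H' HB s t Hs Ht.
assert (Hlin : forall r, 0 <= r <= T ->
  is_dt T (fun y => (g y + (- g' t) * RtoC (y - t))%C) r (g' r + (- g' t) * 1)%C).
{ intros r Hr. apply is_dt_lin; auto.
  apply is_dt_quadratic with 0; auto. intros y Hy.
  replace (RtoC (y - t) - RtoC (r - t) - RtoC (y - r) * 1)%C with (RtoC 0).
  - rewrite Cmod_0. lra.
  - rewrite !RtoC_minus. ring. }
assert (Hr : forall r, Rmin s t <= r <= Rmax s t -> 0 <= r <= T /\ Rabs (r - t) <= Rabs (s - t)).
{ intros r. unfold Rmin, Rmax, Rabs.
  destruct (Rle_dec s t), (Rcase_abs (r - t)), (Rcase_abs (s - t)); lra. }
assert (P := is_dt_bounded_variation T _ _ (2 * B * Rabs (s - t)) HT Hlin s t Hs Ht).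
replace (g s - g t - RtoC (s - t) * g' t)%C with
  (g s + - g' t * RtoC (s - t) - (g t + - g' t * RtoC (t - t)))%C.
2:{ rewrite !RtoC_minus. ring. }
replace (4 * B * (s - t) ^ 2) with (2 * (2 * B * Rabs (s - t)) * Rabs (s - t)).
2:{ rewrite <- (pow2_abs (s - t)). ring. }
apply P. intros r R. destruct (Hr r R) as [Hr1 Hr2].
replace (g' r + - g' t * 1)%C with (g' r - g' t)%C by ring.
eapply Rle_trans.
- apply (is_dt_bounded_variation T g' g'' B HT H'); auto.
  intros q Q. apply HB. revert Q. unfold Rmin, Rmax. destruct (Rle_dec r t); lra.
- apply Rmult_le_compat_l; auto.
  assert (0 <= B) by (eapply Rle_trans; [apply Cmod_ge_0|exact (HB t Ht)]). lra.
Qed.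

(** * Linear functionals *)

Definition Clinear {V : Type} (phi : (V -> C) -> C) : Prop :=
  forall (v w : V -> C) (c : C), phi (fun i => (v i + c * w i)%C) = (phi v + c * phi w)%C.

(* The span of [L] is represented by an arbitrary predicate [Q] that is closed
   under linear combinations. *)
Lemma functional_in_span {V : Type} (Q : ((V -> C) -> C) -> Prop) :
  Q (fun _ => RtoC 0) ->
  (forall g h c, Q g -> Q h -> Q (fun v => (g v + c * h v)%C)) ->
  forall L : list ((V -> C) -> C),
  (forall lam, In lam L -> Clinear lam /\ Q lam) ->
  forall phi, Clinear phi ->
  (forall v, (forall lam, In lam L -> lam v = 0%C) -> phi v = 0%C) -> Q phi.
Proof.
intros Q0 Qlin. induction L as [|lam L IH]; intros HL phi Hphi Hker.
- replace phi with (fun _ : V -> C => RtoC 0); auto.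
  apply functional_extensionality. intros v. symmetry. apply Hker. intros ? [].
- destruct (HL lam (or_introl eq_refl)) as [Llam Qlam].
  assert (HL' : forall mu, In mu L -> Clinear mu /\ Q mu) by (intros; apply HL; now right).
  destruct (classic (exists v, (forall mu, In mu L -> mu v = 0%C) /\ lam v <> 0%C)) as [[v [Kv Hv]]|Hn].
  + set (c := (phi v / lam v)%C).
    assert (Q (fun w => (phi w + (- c) * lam w)%C)).
    { apply IH; auto.
      - intros x y d. rewrite Hphi, Llam. ring.
      - intros w Kw.
        assert (E : phi (fun i => (w i + (- (lam w / lam v)) * v i)%C) = 0%C).
        { apply Hker. intros mu [<-|Hmu].
          - rewrite Llam. field. exact Hv.
          - rewrite (proj1 (HL' mu Hmu)), (Kv mu Hmu), (Kw mu Hmu). ring. }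
        rewrite Hphi in E. rewrite <- E. unfold c. field. exact Hv. }
    replace phi with (fun w => ((phi w + (- c) * lam w) + c * lam w)%C).
    * now apply Qlin.
    * apply functional_extensionality. intros w. ring.
  + apply IH; auto. intros v Kv. apply Hker. intros mu [<-|Hmu]; auto.
    apply NNPP. intros Hv. apply Hn. now exists v.
Qed.

(** * Polynomials and the DG form *)

Lemma pval_S (k : nat) (c : nat -> C) (x : R) :
  pval (S k) c x = (pval k c x + c (S k) * RtoC (x ^ S k))%C.
Proof. unfold pval. now rewrite sum_Sn. Qed.

Lemma pval_0 (c : nat -> C) (x : R) : pval 0 c x = c 0%nat.
Proof. unfold pval. rewrite sum_O. simpl. ring. Qed.

Lemma pval_ext (k : nat) (c d : nat -> C) (x : R) :
  (forall m, (m <= k)%nat -> c m = d m) -> pval k c x = pval k d x.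
Proof.
intros H. apply sum_n_ext_loc. intros m Hm. now rewrite H.
Qed.

Lemma pval_lin (k : nat) (c d : nat -> C) (z : C) (x : R) :
  pval k (fun m => (c m + z * d m)%C) x = (pval k c x + z * pval k d x)%C.
Proof.
induction k as [|k IH]; [rewrite !pval_0; ring|]. rewrite !pval_S, IH. ring.
Qed.

Lemma pval_minus (k : nat) (c d : nat -> C) (x : R) :
  pval k (fun m => (c m - d m)%C) x = (pval k c x - pval k d x)%C.
Proof.
replace (pval k c x - pval k d x)%C with (pval k c x + (- (1)) * pval k d x)%C by ring.
rewrite <- pval_lin. apply pval_ext. intros. ring.
Qed.

Lemma pval_conj (k : nat) (c : nat -> C) (x : R) :
  pval k (fun m => Cconj (c m)) x = Cconj (pval k c x).
Proof.
induction k as [|k IH]; [now rewrite !pval_0|].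
rewrite !pval_S, IH, Cplus_conj, Cmult_conj. f_equal. f_equal. Calg.
Qed.

(** Coefficients of the derivative, padded with 0 from position [k] on: [pval k] then serves for
    derivatives of every order, and the arbitrary coefficients of [c] beyond [k] never enter. *)
Definition dcoef (k : nat) (c : nat -> C) (m : nat) : C :=
  if Nat.ltb m k then (RtoC (INR (S m)) * c (S m))%C else 0%C.

Lemma is_derive_monomial (z : C) (m : nat) (x : R) :
  is_derive (V := C_R_NormedModule) (fun y => (z * RtoC (y ^ m))%C) x
    (z * RtoC (INR m * x ^ pred m))%C.
Proof.
evar_last.
- apply (is_derive_C_mult (fun _ => z)).
  + apply (is_derive_const (V := C_R_NormedModule)).
  + apply is_derive_C_iff with (l := RtoC (INR m * x ^ pred m)). split.
    * apply is_derive_ext with (fun y => y ^ m); [reflexivity|].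
      evar_last; [apply is_derive_pow, (is_derive_id (K := R_AbsRing))|].
      unfold one; simpl. ring.
    * exact (is_derive_const (K := R_AbsRing) (V := R_NormedModule) 0 x).
- change (zero : C_R_NormedModule) with (RtoC 0). ring.
Qed.

Lemma pval_dcoef_S (k : nat) (c : nat -> C) (x : R) :
  pval (S k) (dcoef (S k) c) x =
  (pval k (dcoef k c) x + c (S k) * RtoC (INR (S k) * x ^ k))%C.
Proof.
rewrite pval_S. unfold dcoef at 2. rewrite Nat.ltb_irrefl.
replace (pval k (dcoef (S k) c) x) with
  (pval k (dcoef k c) x + c (S k) * RtoC (INR (S k) * x ^ k))%C; [ring|].
destruct k as [|k].
- rewrite !pval_0. unfold dcoef. simpl. rewrite !Rmult_1_r. ring.
- rewrite !pval_S. unfold dcoef at 2 4.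
  rewrite Nat.ltb_irrefl. replace (Nat.ltb (S k) (S (S k))) with true by (symmetry; apply Nat.ltb_lt; lia).
  replace (pval k (dcoef (S (S k)) c) x) with (pval k (dcoef (S k) c) x).
  + rewrite RtoC_mult. ring.
  + apply pval_ext. intros m Hm. unfold dcoef.
    replace (Nat.ltb m (S k)) with true by (symmetry; apply Nat.ltb_lt; lia).
    replace (Nat.ltb m (S (S k))) with true by (symmetry; apply Nat.ltb_lt; lia). reflexivity.
Qed.

Lemma is_derive_pval (k : nat) (c : nat -> C) (x : R) :
  is_derive (V := C_R_NormedModule) (pval k c) x (pval k (dcoef k c) x).
Proof.
induction k as [|k IH].
- rewrite pval_0. unfold dcoef. simpl.
  apply (is_derive_ext (V := C_R_NormedModule)) with (fun _ => c 0%nat).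
  + intros t. now rewrite pval_0.
  + apply (is_derive_const (V := C_R_NormedModule)).
- rewrite pval_dcoef_S.
  apply (is_derive_ext (V := C_R_NormedModule)) with (fun y => plus (pval k c y : C_R_NormedModule) (c (S k) * RtoC (y ^ S k))%C).
  + intros y. now rewrite pval_S.
  + apply (is_derive_plus (V := C_R_NormedModule)); [exact IH|].
    exact (is_derive_monomial (c (S k)) (S k) x).
Qed.

Lemma ccont_pval (k : nat) (c : nat -> C) (l r : R) : ccont (pval k c) l r.
Proof. apply ccont_derive with (pval k (dcoef k c)). intros. apply is_derive_pval. Qed.

Lemma Dx_pval (k : nat) (c : nat -> C) : Dx (pval k c) = pval k (dcoef k c).
Proof. apply functional_extensionality. intros x. apply Dx_unique, is_derive_pval. Qed.

Lemma dcoef_lin (k : nat) (c d : nat -> C) (z : C) :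
  dcoef k (fun m => (c m + z * d m)%C) = fun m => (dcoef k c m + z * dcoef k d m)%C.
Proof.
apply functional_extensionality. intros m. unfold dcoef. destruct (Nat.ltb m k); ring.
Qed.

Lemma dcoef_minus (k : nat) (c d : nat -> C) :
  dcoef k (fun m => (c m - d m)%C) = fun m => (dcoef k c m - dcoef k d m)%C.
Proof.
apply functional_extensionality. intros m. unfold dcoef. destruct (Nat.ltb m k); ring.
Qed.

Lemma dcoef_conj (k : nat) (c : nat -> C) :
  dcoef k (fun m => Cconj (c m)) = fun m => Cconj (dcoef k c m).
Proof.
apply functional_extensionality. intros m. unfold dcoef.
destruct (Nat.ltb m k); [rewrite Cmult_conj; f_equal|]; Calg.
Qed.

(** Induction on the degree through the derivative, which also vanishes on the open interval and has
    the nonconstant coefficients up to nonzero factors. This converts the uniqueness of the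
    projection as a function into uniqueness of its coefficients. *)
Lemma pval_eq0_coef (k : nat) (c : nat -> C) (l r : R) : l < r ->
  (forall x, l < x < r -> pval k c x = 0%C) -> forall m, (m <= k)%nat -> c m = 0%C.
Proof.
intros Hlr. revert c. induction k as [|k IH]; intros c H.
- intros m Hm. replace m with 0%nat by lia. rewrite <- (H ((l + r) / 2)) by lra. now rewrite pval_0.
- assert (D : forall m, (m <= k)%nat -> c (S m) = 0%C).
  { assert (D : forall m, (m <= k)%nat -> dcoef (S k) c m = 0%C).
    { apply IH. intros x Hx.
      transitivity (pval (S k) (dcoef (S k) c) x).
      { rewrite pval_S. unfold dcoef at 3. rewrite Nat.ltb_irrefl. ring. }
      apply (is_derive_C_unique (pval (S k) c) x); [apply is_derive_pval|].
      apply (is_derive_ext_loc (V := C_R_NormedModule) (fun _ => RtoC 0)).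
      - assert (He : 0 < Rmin (x - l) (r - x)) by (apply Rmin_glb_lt; lra).
        exists (mkposreal _ He). intros y Hy. symmetry. apply H.
        change (Rabs (y - x) < Rmin (x - l) (r - x)) in Hy.
        generalize (Rmin_l (x - l) (r - x)) (Rmin_r (x - l) (r - x)).
        apply Rabs_def2 in Hy. lra.
      - apply (is_derive_const (V := C_R_NormedModule)). }
    intros m Hm. specialize (D m Hm). unfold dcoef in D.
    replace (Nat.ltb m (S k)) with true in D by (symmetry; apply Nat.ltb_lt; lia).
    assert (RtoC (INR (S m)) <> 0%C).
    { intros E. apply RtoC_inj in E. revert E. apply not_0_INR. lia. }
    replace (c (S m)) with (/ RtoC (INR (S m)) * (RtoC (INR (S m)) * c (S m)))%C by (field; auto).
    rewrite D. ring. }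
  intros [|m] Hm; [|apply D; lia].
  assert (E : forall n x, (n <= S k)%nat -> pval n c x = c 0%nat).
  { intros n x. induction n as [|n IHn]; intros Hn; [apply pval_0|].
    rewrite pval_S, IHn, D by lia. ring. }
  rewrite <- (E (S k) ((l + r) / 2)) by lia. apply H. lra.
Qed.

(** The second derivative of a test function lies in the space whose moments the projection
    preserves. The case k = 1 is separate because [k - 2] truncates to 0 there, while the second
    derivative is 0. *)
Lemma pval_dcoef2 (k : nat) (c : nat -> C) (x : R) : (1 <= k)%nat ->
  pval k (dcoef k (dcoef k c)) x =
    if Nat.leb 2 k then pval (k - 2) (dcoef k (dcoef k c)) x else 0%C.
Proof.
intros Hk. destruct k as [|[|k]]; [lia| |].
- simpl. rewrite pval_S, pval_0. unfold dcoef. simpl. ring.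
- replace (Nat.leb 2 (S (S k))) with true by reflexivity.
  replace (S (S k) - 2)%nat with k by lia.
  rewrite !pval_S.
  replace (dcoef (S (S k)) (dcoef (S (S k)) c) (S (S k))) with (RtoC 0).
  2:{ unfold dcoef at 1. now rewrite Nat.ltb_irrefl. }
  replace (dcoef (S (S k)) (dcoef (S (S k)) c) (S k)) with (RtoC 0).
  2:{ unfold dcoef. rewrite Nat.ltb_irrefl. destruct (Nat.ltb (S k) (S (S k))); ring. }
  ring.
Qed.

(** * Traces, fluxes and the space part of the scheme *)

Lemma ev_minus (k : nat) (v w : Vh) :
  ev k (fun j m => (v j m - w j m)%C) = fun j x => (ev k v j x - ev k w j x)%C.
Proof.
apply functional_extensionality; intros j. apply functional_extensionality; intros x.
apply pval_minus.
Qed.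

Lemma Dxb_ev (k : nat) (v : Vh) : Dxb (ev k v) = ev k (fun j => dcoef k (v j)).
Proof.
apply functional_extensionality; intros j. apply functional_extensionality; intros x.
unfold Dxb, ev. now rewrite Dx_pval.
Qed.

Lemma flux_u_lin (a b : R) (k N : nat) (al1 be2 : R) (v w : Vh) (z : C) (i : nat) :
  flux_u a b N al1 be2 (ev k (fun j m => (v j m + z * w j m)%C)) i =
  (flux_u a b N al1 be2 (ev k v) i + z * flux_u a b N al1 be2 (ev k w) i)%C.
Proof.
unfold flux_u, avg, jump, trp, trm. rewrite !Dxb_ev. unfold ev.
rewrite !dcoef_lin, !pval_lin. ring.
Qed.

Lemma flux_ux_lin (a b : R) (k N : nat) (al1 be1 : R) (v w : Vh) (z : C) (i : nat) :
  flux_ux a b N al1 be1 (ev k (fun j m => (v j m + z * w j m)%C)) i =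
  (flux_ux a b N al1 be1 (ev k v) i + z * flux_ux a b N al1 be1 (ev k w) i)%C.
Proof.
unfold flux_ux, avg, jump, trp, trm. rewrite !Dxb_ev. unfold ev.
rewrite !dcoef_lin, !pval_lin. ring.
Qed.

Lemma flux_u_minus (a b : R) (k N : nat) (al1 be2 : R) (v w : Vh) (i : nat) :
  flux_u a b N al1 be2 (ev k (fun j m => (v j m - w j m)%C)) i =
  (flux_u a b N al1 be2 (ev k v) i - flux_u a b N al1 be2 (ev k w) i)%C.
Proof.
unfold flux_u, avg, jump, trp, trm. rewrite !Dxb_ev. unfold ev.
rewrite !dcoef_minus, !pval_minus. ring.
Qed.

Lemma flux_ux_minus (a b : R) (k N : nat) (al1 be1 : R) (v w : Vh) (i : nat) :
  flux_ux a b N al1 be1 (ev k (fun j m => (v j m - w j m)%C)) i =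
  (flux_ux a b N al1 be1 (ev k v) i - flux_ux a b N al1 be1 (ev k w) i)%C.
Proof.
unfold flux_ux, avg, jump, trp, trm. rewrite !Dxb_ev. unfold ev.
rewrite !dcoef_minus, !pval_minus. ring.
Qed.

Lemma trp_0N (a b : R) (N : nat) (w : bfun) : (1 <= N)%nat -> trp a b N w N = trp a b N w 0.
Proof. intros HN. unfold trp. now rewrite Nat.Div0.mod_same, Nat.Div0.mod_0_l. Qed.

Lemma trm_0N (a b : R) (N : nat) (w : bfun) : (1 <= N)%nat -> trm a b N w N = trm a b N w 0.
Proof.
intros HN. unfold trm.
replace (Nat.modulo (N + N - 1) N) with (Nat.modulo (0 + N - 1) N); [reflexivity|].
replace (N + N - 1)%nat with (0 + N - 1 + 1 * N)%nat by lia.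
now rewrite Nat.Div0.mod_add.
Qed.

Lemma trp_cell (a b : R) (N : nat) (w : bfun) (j : nat) : (j < N)%nat ->
  trp a b N w j = w j (node a b N j).
Proof. intros Hj. unfold trp. now rewrite Nat.mod_small. Qed.

Lemma trm_cell (a b : R) (N : nat) (w : bfun) (j : nat) : (j < N)%nat ->
  trm a b N w (S j) = w j (node a b N (S j)).
Proof.
intros Hj. unfold trm.
replace (Nat.modulo (S j + N - 1) N) with j; [reflexivity|].
replace (S j + N - 1)%nat with (j + 1 * N)%nat by lia.
now rewrite Nat.Div0.mod_add, Nat.mod_small.
Qed.

Lemma flux_u_0N (a b : R) (N : nat) (al1 be2 : R) (w : bfun) : (1 <= N)%nat ->
  flux_u a b N al1 be2 w N = flux_u a b N al1 be2 w 0.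
Proof. intros HN. unfold flux_u, avg, jump. now rewrite !trp_0N, !trm_0N. Qed.

Lemma flux_ux_0N (a b : R) (N : nat) (al1 be1 : R) (w : bfun) : (1 <= N)%nat ->
  flux_ux a b N al1 be1 w N = flux_ux a b N al1 be1 w 0.
Proof. intros HN. unfold flux_ux, avg, jump. now rewrite !trp_0N, !trm_0N. Qed.

Definition dg_form (a b : R) (N : nat) (al1 be1 be2 : R) (w : bfun) (v : R -> C) (j : nat) : C :=
  let xl := node a b N j in
  let xr := node a b N (S j) in
  (CInt (fun x => w j x * Dx (Dx v) x) xl xr
   - flux_u a b N al1 be2 w (S j) * Dx v xr
   + flux_u a b N al1 be2 w j * Dx v xl
   + flux_ux a b N al1 be1 w (S j) * v xr
   - flux_ux a b N al1 be1 w j * v xl)%C.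

Lemma hmesh_pos (a b : R) (N : nat) : a < b -> (1 <= N)%nat -> 0 < hmesh a b N.
Proof. intros Hab HN. apply Rdiv_lt_0_compat; [lra|]. apply lt_0_INR. lia. Qed.

Lemma node_lt (a b : R) (N j : nat) : a < b -> (1 <= N)%nat -> node a b N j < node a b N (S j).
Proof.
intros Hab HN. unfold node. rewrite S_INR. generalize (hmesh_pos a b N Hab HN). lra.
Qed.

Lemma node_0 (a b : R) (N : nat) : node a b N 0 = a.
Proof. unfold node. simpl. ring. Qed.

Lemma node_N (a b : R) (N : nat) : (1 <= N)%nat -> node a b N N = b.
Proof. intros HN. unfold node, hmesh. field. apply not_0_INR. lia. Qed.

Lemma dg_form_minus (a b : R) (k N : nat) (al1 be1 be2 : R) (v w : Vh) (c : nat -> C) (j : nat) :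
  a < b -> (1 <= N)%nat ->
  dg_form a b N al1 be1 be2 (ev k (fun j m => (v j m - w j m)%C)) (pval k c) j =
  (dg_form a b N al1 be1 be2 (ev k v) (pval k c) j
   - dg_form a b N al1 be1 be2 (ev k w) (pval k c) j)%C.
Proof.
intros Hab HN. unfold dg_form. rewrite !flux_u_minus, !flux_ux_minus, !Dx_pval.
assert (Hn := node_lt a b N j Hab HN).
rewrite (CInt_ext _ (fun x => (ev k v j x * pval k (dcoef k (dcoef k c)) x
   - ev k w j x * pval k (dcoef k (dcoef k c)) x)%C)).
2:{ lra. }
2:{ intros x _. unfold ev. rewrite pval_minus. ring. }
rewrite CInt_minus; [ring|lra| |]; apply ccont_mult; apply ccont_pval.
Qed.

Lemma sum_n_S_R (g : nat -> R) (n : nat) : sum_n g (S n) = sum_n g n + g (S n).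
Proof. now rewrite sum_Sn. Qed.

(* Integrating by parts, the contribution of each interface to the form is real;
   collecting it needs the shift from [S j] to [j] of the left traces. *)
Lemma dg_form_real (a b : R) (k N : nat) (al1 be1 be2 : R) (v : Vh) :
  a < b -> (1 <= N)%nat ->
  sum_n (fun j => Im (dg_form a b N al1 be1 be2 (ev k v) (pval k (fun m => Cconj (v j m))) j)) (N - 1) = 0.
Proof.
intros Hab HN.
set (w := ev k v). set (wx := Dxb w).
set (fu := flux_u a b N al1 be2 w). set (fx := flux_ux a b N al1 be1 w).
(* What one side of interface [i] contributes after integration by parts, [p] and [q] being the
   traces of the function and of its derivative on that side. *)
set (bd := fun (i : nat) (p q : C) => Im (p * Cconj q - fu i * Cconj q + fx i * Cconj p)%C).
set (gm := fun i => bd i (trm a b N w i) (trm a b N wx i)).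
set (gp := fun i => bd i (trp a b N w i) (trp a b N wx i)).
(* The products of averages with jumps cancel against the fluxes. Across the interface the bracket
   jumps by 2 Re([w] conj {w_x}) + 2 al1 Re([w] conj [w_x]) + be1 |[w]|^2 - be2 |[w_x]|^2, which is
   real. *)
assert (Hg : forall i, gm i = gp i).
{ intros i. unfold gm, gp, bd, fu, fx, flux_u, flux_ux, jump, avg.
  fold wx.
  destruct (trm a b N w i), (trm a b N wx i), (trp a b N w i), (trp a b N wx i).
  unfold Im, Cconj; simpl. field. }
assert (HN0 : gm N = gm 0%nat).
{ unfold gm, bd, fu, fx. now rewrite !trm_0N, flux_u_0N, flux_ux_0N. }
assert (Hj : forall j, (j < N)%nat ->
  Im (dg_form a b N al1 be1 be2 w (pval k (fun m => Cconj (v j m))) j) = gm (S j) - gm j).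
{ intros j Hj. rewrite (Hg j). unfold gm, gp.
  rewrite !trm_cell, !trp_cell by auto.
  unfold dg_form. rewrite !Dx_pval. fold fu fx.
  assert (Hn := node_lt a b N j Hab HN).
  set (l := node a b N j) in *. set (r := node a b N (S j)) in *.
  set (cv := fun m => Cconj (v j m)).
  assert (Ewx : wx j = pval k (dcoef k (v j))) by (unfold wx, w; rewrite Dxb_ev; reflexivity).
  assert (Ecv : forall x, pval k cv x = Cconj (w j x)) by (intros; apply pval_conj).
  assert (Ecvx : forall x, pval k (dcoef k cv) x = Cconj (wx j x)).
  { intros x. unfold cv. rewrite dcoef_conj, pval_conj, Ewx. reflexivity. }
  (* A single integration by parts: the remaining volume term is the integral of |w_x|^2, which is
     real and disappears from the imaginary part. *)
  assert (IBP : (CInt (fun x => wx j x * Cconj (wx j x)) l r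
     + CInt (fun x => w j x * pval k (dcoef k (dcoef k cv)) x) l r)%C =
     (w j r * Cconj (wx j r) - w j l * Cconj (wx j l))%C).
  { rewrite <- !Ecvx. rewrite <- CInt_plus; [|lra| |].
    - apply (CInt_FTC (fun x => (w j x * pval k (dcoef k cv) x)%C)); [lra| |].
      + intros x _. rewrite <- Ecvx, Ewx. apply is_derive_C_mult; apply is_derive_pval.
      + apply ccont_plus; apply ccont_mult; try apply ccont_conj; try rewrite Ewx; apply ccont_pval.
    - rewrite Ewx. apply ccont_mult; try apply ccont_conj; apply ccont_pval.
    - apply ccont_mult; apply ccont_pval. }
  assert (HR : Im (CInt (fun x => wx j x * Cconj (wx j x))%C l r) = 0).
  { rewrite Im_CInt; [|lra|].
    - rewrite (RInt_ext _ (fun _ => 0)).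
      + rewrite RInt_const. unfold scal; simpl. unfold mult; simpl. ring.
      + intros x _. unfold Im; simpl. ring.
    - rewrite Ewx. apply ccont_mult; try apply ccont_conj; apply ccont_pval. }
  rewrite !Ecv, !Ecvx.
  match goal with |- Im (CInt ?g l r - ?A + ?B + ?D - ?E)%C = _ =>
    replace (CInt g l r) with
     ((w j r * Cconj (wx j r) - w j l * Cconj (wx j l)) - CInt (fun x => wx j x * Cconj (wx j x)) l r)%C
     by (rewrite <- IBP; unfold w, ev; ring) end.
  unfold bd.
  revert HR. generalize (CInt (fun x => wx j x * Cconj (wx j x))%C l r).
  generalize (w j l) (w j r) (wx j l) (wx j r) (fu j) (fu (S j)) (fx j) (fx (S j)).
  intros [] [] [] [] [] [] [] [] [z1 z2]. unfold Im; simpl. intros ->. ring. }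
rewrite (sum_n_ext_loc _ (fun j => gm (S j) - gm j)) by (intros; apply Hj; lia).
assert (Tel : forall n, sum_n (fun j => gm (S j) - gm j) n = gm (S n) - gm 0%nat :> R).
{ induction n as [|n IH]; [now rewrite sum_O|]. rewrite sum_n_S_R, IH. ring. }
rewrite Tel. replace (S (N - 1)) with N by lia. rewrite HN0. exact (Rminus_diag_eq _ _ eq_refl).
Qed.

(** * The error equation *)

Lemma Dx_periodic (g : R -> C) (p x : R) : (forall y, g (y + p) = g y) ->
  (forall y, exists l, is_derive (V := C_R_NormedModule) g y l) -> Dx g (x + p) = Dx g x.
Proof.
intros Hp Hd. destruct (Hd (x + p)) as [l Hl]. rewrite (Dx_unique _ _ _ Hl).
symmetry. apply Dx_unique.
apply (is_derive_ext (V := C_R_NormedModule)) with (fun y => g (y + p)); auto.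
replace l with (scal 1 l : C_R_NormedModule).
2:{ rewrite scal_R_Cmult. apply Cmult_1_l. }
apply (is_derive_comp (V := C_R_NormedModule) g (fun y => y + p)); auto.
auto_derive; auto.
Qed.

(** The projection conditions are imposed at right ends of cells only; interface 0 is reached from
    interface N by periodicity of the fluxes, of [g] and of its derivative. *)
Lemma flux_proj (a b : R) (k N : nat) (al1 be1 be2 : R) (g : R -> C) (w : bfun) :
  (1 <= N)%nat -> (forall x, g (x + (b - a)) = g x) ->
  (forall y, exists l, is_derive (V := C_R_NormedModule) g y l) ->
  proj_conditions a b k N al1 be1 be2 g w ->
  forall i, (i <= N)%nat -> flux_u a b N al1 be2 w i = g (node a b N i) /\
    flux_ux a b N al1 be1 w i = Dx g (node a b N i).
Proof.
intros HN Hp Hd HP i Hi.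
assert (HS : forall j, (j < N)%nat -> flux_u a b N al1 be2 w (S j) = g (node a b N (S j)) /\
    flux_ux a b N al1 be1 w (S j) = Dx g (node a b N (S j))) by (intros j Hj; apply HP, Hj).
destruct i as [|i]; [|apply HS; lia].
destruct (HS (N - 1)%nat) as [A B]; [lia|].
replace (S (N - 1)) with N in A, B by lia.
rewrite flux_u_0N, node_N in A by auto. rewrite flux_ux_0N, node_N in B by auto.
rewrite A, B, node_0.
replace b with (a + (b - a)) by ring. split; [apply Hp|].
replace (a + (b - a) - a) with (b - a) by ring. now apply Dx_periodic.
Qed.

(** Consistency of the projection: fluxes and moments can be replaced by those of [g], and Green's
    identity for [g] and the test function then absorbs all boundary terms. *)
Lemma dg_form_proj (a b : R) (k N : nat) (al1 be1 be2 : R) (g g' g'' : R -> C) (P : Vh)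
  (c : nat -> C) (j : nat) :
  a < b -> (1 <= k)%nat -> (j < N)%nat -> (forall x, g (x + (b - a)) = g x) ->
  (forall x, is_derive (V := C_R_NormedModule) g x (g' x)) ->
  (forall x, is_derive (V := C_R_NormedModule) g' x (g'' x)) ->
  (forall l r, ccont g'' l r) ->
  proj_conditions a b k N al1 be1 be2 g (ev k P) ->
  dg_form a b N al1 be1 be2 (ev k P) (pval k c) j =
  CInt (fun x => (g'' x * pval k c x)%C) (node a b N j) (node a b N (S j)).
Proof.
intros Hab Hk Hj Hp D1 D2 Cg'' HP.
assert (HN : (1 <= N)%nat) by lia.
assert (Hn := node_lt a b N j Hab HN).
assert (F := flux_proj a b k N al1 be1 be2 g (ev k P) HN Hp (fun y => ex_intro _ _ (D1 y)) HP).
destruct (F j) as [F1 F2]; [lia|]. destruct (F (S j)) as [F3 F4]; [lia|].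
unfold dg_form. rewrite F1, F2, F3, F4, !Dx_pval.
rewrite !(Dx_unique _ _ _ (D1 _)).
set (l := node a b N j) in *. set (r := node a b N (S j)) in *.
assert (Cg : ccont g l r) by (apply ccont_derive with g'; auto).
assert (Cg' : ccont g' l r) by (apply ccont_derive with g''; auto).
assert (EI : CInt (fun x => (ev k P j x * pval k (dcoef k (dcoef k c)) x)%C) l r =
             CInt (fun x => (g x * pval k (dcoef k (dcoef k c)) x)%C) l r).
{ destruct (Nat.le_gt_cases 2 k) as [H2|H2].
  - assert (E2 := proj1 (HP j Hj) H2 (dcoef k (dcoef k c))). fold l r in E2.
    rewrite (CInt_ext _ (fun x => (ev k P j x * pval (k - 2) (dcoef k (dcoef k c)) x)%C)).
    + rewrite E2. apply CInt_ext; [lra|]. intros x _. rewrite (pval_dcoef2 k) by auto.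
      now rewrite (proj2 (Nat.leb_le 2 k) H2).
    + lra.
    + intros x _. rewrite (pval_dcoef2 k) by auto. now rewrite (proj2 (Nat.leb_le 2 k) H2).
  - apply CInt_ext; [lra|]. intros x _. rewrite (pval_dcoef2 k) by auto.
    rewrite (proj2 (Nat.leb_gt 2 k) H2). ring. }
rewrite EI.
assert (IBP : CInt (fun x => (g'' x * pval k c x - g x * pval k (dcoef k (dcoef k c)) x)%C) l r =
  ((g' r * pval k c r - g r * pval k (dcoef k c) r) - (g' l * pval k c l - g l * pval k (dcoef k c) l))%C).
{ apply (CInt_FTC (fun x => (g' x * pval k c x - g x * pval k (dcoef k c) x)%C)); [lra| |].
  - intros x _.
    replace (g'' x * pval k c x - g x * pval k (dcoef k (dcoef k c)) x)%C with
      ((g'' x * pval k c x + g' x * pval k (dcoef k c) x) -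
       (g' x * pval k (dcoef k c) x + g x * pval k (dcoef k (dcoef k c)) x))%C by ring.
    apply is_derive_C_minus; apply is_derive_C_mult; auto; apply is_derive_pval.
  - apply ccont_minus; apply ccont_mult; auto; apply ccont_pval. }
rewrite CInt_minus in IBP; [|lra| |]; try (apply ccont_mult; auto; apply ccont_pval).
replace (CInt (fun x => (g'' x * pval k c x)%C) l r) with
  ((CInt (fun x => (g'' x * pval k c x)%C) l r - CInt (fun x => (g x * pval k (dcoef k (dcoef k c)) x)%C) l r)
   + CInt (fun x => (g x * pval k (dcoef k (dcoef k c)) x)%C) l r)%C by ring.
rewrite IBP. ring.
Qed.

(** * The nonlinear term *)

Definition nlin (f : R -> R) (z : C) : C := (RtoC (f (Cmod z ^ 2)%R) * z)%C.

Lemma ccont_nlin (f : R -> R) (K : Rbar) (M : R) (g : R -> C) (l r : R) :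
  W2inf_le K f M -> ccont g l r ->
  (forall x, l <= x <= r -> Rbar_le (Cmod (g x) ^ 2) K) -> ccont (fun x => nlin f (g x)) l r.
Proof.
intros HW Hg HK. apply ccont_mult; auto. apply ccont_RtoC. intros x Hx.
apply continuous_comp with (f := fun y => Cmod (g y) ^ 2).
- now apply continuous_Cmod2 with l r.
- apply (ex_derive_continuous (K := R_AbsRing) (V := R_NormedModule)).
  destruct (HW (Cmod (g x) ^ 2) (pow2_ge_0 _) (HK x Hx) 1%nat) as [A _]; auto.
Qed.

(** Time is frozen: [gt] and [dU] play the time derivatives of u and u_h. Subtracting the scheme
    from the equation for u leaves the discrete error [P - U] in the space part, but the full error
    in the other two terms. *)
Lemma error_equation (a b : R) (k N : nat) (al1 be1 be2 M : R) (f : R -> R) (K : Rbar)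
  (g gt g' g'' : R -> C) (P U dU : Vh) (c : nat -> C) (j : nat) :
  a < b -> (1 <= k)%nat -> (j < N)%nat -> (forall x, g (x + (b - a)) = g x) ->
  (forall x, is_derive (V := C_R_NormedModule) g x (g' x)) ->
  (forall x, is_derive (V := C_R_NormedModule) g' x (g'' x)) ->
  (forall l r, ccont g'' l r) -> (forall l r, ccont gt l r) ->
  W2inf_le K f M -> (forall x, Rbar_le (Cmod (g x) ^ 2) K) ->
  (forall x, node a b N j <= x <= node a b N (S j) -> Rbar_le (Cmod (ev k U j x) ^ 2) K) ->
  (forall x, (Ci * gt x + g'' x + nlin f (g x) = 0)%C) ->
  proj_conditions a b k N al1 be1 be2 g (ev k P) ->
  (let I h := CInt (fun x => (h x * pval k c x)%C) (node a b N j) (node a b N (S j)) in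
   (Ci * I (ev k dU j) + dg_form a b N al1 be1 be2 (ev k U) (pval k c) j
    + I (fun x => nlin f (ev k U j x)) = 0)%C ->
   (Ci * I (fun x => gt x - ev k dU j x)
    + dg_form a b N al1 be1 be2 (ev k (fun j m => P j m - U j m)) (pval k c) j
    + I (fun x => nlin f (g x) - nlin f (ev k U j x)) = 0))%C.
Proof.
intros Hab Hk Hj Hp D1 D2 Cg'' Cgt HW HKg HKU NLS HP I DG.
assert (HN : (1 <= N)%nat) by lia.
assert (Hn := node_lt a b N j Hab HN).
rewrite dg_form_minus by auto.
rewrite (dg_form_proj a b k N al1 be1 be2 g g' g'' P c j) by auto.
change (CInt (fun x => (g'' x * pval k c x)%C) (node a b N j) (node a b N (S j))) with (I g'').
set (l := node a b N j) in *. set (r := node a b N (S j)) in *.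
assert (CU : ccont (ev k U j) l r) by apply ccont_pval.
assert (Cg : ccont g l r) by (apply ccont_derive with g'; auto).
assert (CFU : ccont (fun x => nlin f (ev k U j x)) l r) by (apply ccont_nlin with K M; auto).
assert (CFg : ccont (fun x => nlin f (g x)) l r) by (apply ccont_nlin with K M; auto).
assert (Im' : forall h1 h2, ccont h1 l r -> ccont h2 l r -> I (fun x => (h1 x - h2 x)%C) = (I h1 - I h2)%C).
{ intros h1 h2 C1 C2. unfold I.
  rewrite <- CInt_minus; [|lra| |]; try (apply ccont_mult; auto; apply ccont_pval).
  apply CInt_ext; [lra|]. intros; ring. }
rewrite !Im' by (auto; apply ccont_pval).
assert (E : (Ci * I gt + I g'' + I (fun x => nlin f (g x)))%C = 0%C).
{ assert (C1 : ccont (fun x => (gt x * pval k c x)%C) l r) by (apply ccont_mult; auto; apply ccont_pval).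
  assert (C1' : ccont (fun x => (Ci * (gt x * pval k c x))%C) l r) by (apply ccont_mult; auto; apply ccont_const).
  assert (C2 : ccont (fun x => (g'' x * pval k c x)%C) l r) by (apply ccont_mult; auto; apply ccont_pval).
  assert (C3 : ccont (fun x => (nlin f (g x) * pval k c x)%C) l r) by (apply ccont_mult; auto; apply ccont_pval).
  unfold I. rewrite <- CInt_scal, <- CInt_plus, <- CInt_plus; auto; try lra.
  2:{ now apply ccont_plus. }
  rewrite <- (CInt_0 l r) by lra.
  apply CInt_ext; [lra|]. intros x _.
  transitivity ((Ci * gt x + g'' x + nlin f (g x)) * pval k c x)%C; [ring|]. rewrite NLS. ring. }
match goal with |- ?X = _ => transitivity (0 - 0)%C; [|ring] end.
rewrite <- DG at 2. rewrite <- E. ring.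
Qed.

(** The weight is the modulus of [z], the argument bounded by [B]; [w] stands for the numerical
    value, which has no bound. *)
Lemma nlin_difference (f : R -> R) (K : Rbar) (M B : R) (z w : C) :
  W2inf_le K f M -> Rbar_le (Cmod z ^ 2) K -> Rbar_le (Cmod w ^ 2) K -> Cmod z <= B ->
  Rabs (f (Cmod z ^ 2) - f (Cmod w ^ 2)) * Cmod z <= M * (B * (3 * B + 3)) * Cmod (z - w)%C.
Proof.
intros HW Hz Hw HB.
assert (Hz0 := Cmod_ge_0 z). assert (Hw0 := Cmod_ge_0 w). assert (Hd0 := Cmod_ge_0 (z - w)%C).
set (d := Cmod (z - w)%C) in *.
assert (Tri : Rabs (Cmod z - Cmod w) <= d).
{ apply Rabs_le. unfold d. split.
  - assert (Cmod w <= Cmod (- (z - w))%C + Cmod z).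
    { replace w with (- (z - w) + z)%C at 1 by ring. apply Cmod_triangle. }
    rewrite Cmod_opp in H. lra.
  - assert (Cmod z <= Cmod (z - w)%C + Cmod w).
    { replace z with (z - w + w)%C at 1 by ring. apply Cmod_triangle. }
    lra. }
assert (Hf : forall s, 0 <= s -> Rbar_le s K -> ex_derive f s /\ Rabs (f s) <= M /\ Rabs (Derive f s) <= M).
{ intros s Hs HsK. destruct (HW s Hs HsK 0%nat) as [_ A]; [lia|].
  destruct (HW s Hs HsK 1%nat) as [A1 A2]; [lia|]. auto. }
destruct (Hf _ (pow2_ge_0 _) Hz) as [_ [Mz _]]. destruct (Hf _ (pow2_ge_0 _) Hw) as [_ [Mw _]].
assert (HM : 0 <= M) by (eapply Rle_trans; [apply Rabs_pos|exact Mz]).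
(* In the first case |z| + |w| <= 3B + 1. In the second, |z - w| >= 1 and the trivial bound 2M must
   be covered; the factor 3B + 3 serves both. *)
destruct (Rle_dec (Cmod w) (2 * B + 1)) as [Hs|Hl].
(* [f] is controlled on [0, K] only; the segment between the squared moduli stays there because its
   upper end is one of them. *)
- assert (Hx : forall x, Rmin (Cmod w ^ 2) (Cmod z ^ 2) <= x <= Rmax (Cmod w ^ 2) (Cmod z ^ 2) ->
    ex_derive f x /\ Rabs (f x) <= M /\ Rabs (Derive f x) <= M).
  { intros x [X1 X2]. apply Hf.
    - eapply Rle_trans; [|exact X1]. apply Rmin_glb; apply pow2_ge_0.
    - apply Rbar_le_trans with (Rmax (Cmod w ^ 2) (Cmod z ^ 2)); [exact X2|].
      unfold Rmax. destruct (Rle_dec (Cmod w ^ 2) (Cmod z ^ 2)); assumption. }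
  destruct (MVT_gen f (Cmod w ^ 2) (Cmod z ^ 2) (Derive f)) as [c [Hc Ec]].
  + intros x X. apply Derive_correct, Hx. lra.
  + intros x X. apply continuity_pt_filterlim.
    apply (ex_derive_continuous (K := R_AbsRing) (V := R_NormedModule)). apply Hx, X.
  + assert (Rabs (Derive f c) <= M) by apply Hx, Hc.
    rewrite Ec, Rabs_mult.
    replace (Cmod z ^ 2 - Cmod w ^ 2) with ((Cmod z + Cmod w) * (Cmod z - Cmod w)) by ring.
    rewrite Rabs_mult, (Rabs_pos_eq (Cmod z + Cmod w)) by lra.
    assert ((Cmod z + Cmod w) * Rabs (Cmod z - Cmod w) <= (3 * B + 3) * d).
    { apply Rmult_le_compat; try lra. apply Rabs_pos. }
    assert (0 <= (Cmod z + Cmod w) * Rabs (Cmod z - Cmod w)) by (apply Rmult_le_pos; [lra|apply Rabs_pos]).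
    assert (Rabs (Derive f c) * ((Cmod z + Cmod w) * Rabs (Cmod z - Cmod w)) <= M * ((3 * B + 3) * d)).
    { apply Rmult_le_compat; auto. apply Rabs_pos. }
    replace (M * (B * (3 * B + 3)) * d) with ((M * ((3 * B + 3) * d)) * B) by ring.
    apply Rmult_le_compat; auto.
    apply Rmult_le_pos; auto. apply Rabs_pos.
- assert (Hd : 1 <= d).
  { apply Rnot_le_lt in Hl. revert Tri. unfold Rabs. destruct (Rcase_abs (Cmod z - Cmod w)); lra. }
  assert (Rabs (f (Cmod z ^ 2) - f (Cmod w ^ 2)) <= 2 * M).
  { eapply Rle_trans; [apply Rabs_triang|]. rewrite Rabs_Ropp. lra. }
  assert (Rabs (f (Cmod z ^ 2) - f (Cmod w ^ 2)) * Cmod z <= 2 * M * B).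
  { apply Rmult_le_compat; auto. apply Rabs_pos. }
  assert (0 <= M * B) by (apply Rmult_le_pos; lra).
  assert (0 <= M * B * B) by (apply Rmult_le_pos; lra).
  assert (0 <= M * B * (d - 1)) by (apply Rmult_le_pos; lra).
  assert (0 <= M * B * B * d) by (apply Rmult_le_pos; lra).
  nra.
Qed.

(** The difference is split as f(|w|^2) (z - w) + (f(|z|^2) - f(|w|^2)) z, so that the second factor
    is the bounded [z]. In the first summand e conj e is real, and only p conj e is left in the
    imaginary part. *)
Lemma nlin_energy (f : R -> R) (K : Rbar) (M B : R) (z w p e : C) :
  W2inf_le K f M -> Rbar_le (Cmod z ^ 2) K -> Rbar_le (Cmod w ^ 2) K -> Cmod z <= B ->
  (z - w = p + e)%C ->
  Rabs (Im ((nlin f z - nlin f w) * Cconj e)%C) <=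
  M * (1 + B * (3 * B + 3)) * (Cmod p * Cmod e + Cmod e ^ 2).
Proof.
intros HW Hz Hw HB E.
assert (Hp0 := Cmod_ge_0 p). assert (He0 := Cmod_ge_0 e).
assert (HM : Rabs (f (Cmod w ^ 2)) <= M).
{ destruct (HW _ (pow2_ge_0 (Cmod w)) Hw 0%nat) as [_ A]; auto. }
assert (HL := nlin_difference f K M B z w HW Hz Hw HB).
set (D := f (Cmod z ^ 2) - f (Cmod w ^ 2)) in *.
replace (Im ((nlin f z - nlin f w) * Cconj e)%C) with
  (f (Cmod w ^ 2) * Im (p * Cconj e)%C + D * Im (z * Cconj e)%C).
2:{ replace ((nlin f z - nlin f w) * Cconj e)%C with
      (RtoC (f (Cmod w ^ 2)%R) * ((z - w) * Cconj e) + RtoC D * (z * Cconj e))%C.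
    - rewrite E. unfold Im, Cconj; simpl. ring.
    - unfold nlin, D. rewrite RtoC_minus. ring. }
eapply Rle_trans; [apply Rabs_triang|]. rewrite !Rabs_mult.
assert (A1 : Rabs (Im (p * Cconj e)%C) <= Cmod p * Cmod e).
{ rewrite <- (Cmod_conj e), <- Cmod_mult. apply im_le_Cmod. }
assert (A2 : Rabs (Im (z * Cconj e)%C) <= Cmod z * Cmod e).
{ rewrite <- (Cmod_conj e), <- Cmod_mult. apply im_le_Cmod. }
assert (A3 : Cmod (z - w)%C <= Cmod p + Cmod e) by (rewrite E; apply Cmod_triangle).
assert (HB0 : 0 <= B) by (generalize (Cmod_ge_0 z); lra).
assert (HM0 : 0 <= M) by (generalize (Rabs_pos (f (Cmod w ^ 2))); lra).
assert (HLg : 0 <= M * (B * (3 * B + 3))) by (repeat apply Rmult_le_pos; lra).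
assert (Hpe : 0 <= Cmod p * Cmod e) by (apply Rmult_le_pos; lra).
assert (S1 : Rabs (f (Cmod w ^ 2)) * Rabs (Im (p * Cconj e)%C) <= M * (Cmod p * Cmod e)).
{ apply Rmult_le_compat; auto; apply Rabs_pos. }
assert (S2 : Rabs D * Rabs (Im (z * Cconj e)%C) <= M * (B * (3 * B + 3)) * (Cmod p + Cmod e) * Cmod e).
{ eapply Rle_trans; [apply Rmult_le_compat_l; [apply Rabs_pos|exact A2]|].
  rewrite <- Rmult_assoc. apply Rmult_le_compat_r; auto.
  eapply Rle_trans; [exact HL|]. apply Rmult_le_compat_l; auto. }
assert (0 <= M * Cmod e ^ 2) by (apply Rmult_le_pos; [lra|apply pow2_ge_0]).
nra.
Qed.

(** * The energy inequality *)

Definition bint (a b : R) (N : nat) (h : nat -> R -> R) : R :=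
  sum_n (fun j => RInt (h j) (node a b N j) (node a b N (S j))) (N - 1).

Definition bcont (a b : R) (N : nat) (h : nat -> R -> R) : Prop :=
  forall j x, (j < N)%nat -> node a b N j <= x <= node a b N (S j) -> continuous (h j) x.

Lemma sum_n_le_loc (g h : nat -> R) (n : nat) :
  (forall j, (j <= n)%nat -> g j <= h j) -> sum_n g n <= sum_n h n.
Proof.
induction n as [|n IH]; intros H; [rewrite !sum_O; apply H; lia|].
rewrite !sum_n_S_R. apply Rplus_le_compat; [apply IH; intros; apply H; lia|apply H; lia].
Qed.

Lemma sum_n_lin (p q : R) (g h : nat -> R) (n : nat) :
  sum_n (fun j => p * g j + q * h j) n = p * sum_n g n + q * sum_n h n.
Proof.
induction n as [|n IH]; [now rewrite !sum_O|]. rewrite !sum_n_S_R, IH.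
match goal with |- ?x = ?y => change (x = y :> R) end. ring.
Qed.

Lemma bcont_ex_RInt (a b : R) (N : nat) (h : nat -> R -> R) (j : nat) :
  a < b -> (1 <= N)%nat -> bcont a b N h -> (j < N)%nat ->
  ex_RInt (h j) (node a b N j) (node a b N (S j)).
Proof.
intros Hab HN H Hj. apply ex_RInt_cont; [left; now apply node_lt|]. intros x Hx. now apply H.
Qed.

Lemma bint_le (a b : R) (N : nat) (g h : nat -> R -> R) :
  a < b -> (1 <= N)%nat -> bcont a b N g -> bcont a b N h ->
  (forall j x, (j < N)%nat -> node a b N j <= x <= node a b N (S j) -> g j x <= h j x) ->
  bint a b N g <= bint a b N h.
Proof.
intros Hab HN Cg Ch H. apply sum_n_le_loc. intros j Hj. apply RInt_le.
- left; now apply node_lt.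
- apply bcont_ex_RInt; auto; lia.
- apply bcont_ex_RInt; auto; lia.
- intros x Hx. apply H; [lia|lra].
Qed.

Lemma bint_lin (a b : R) (N : nat) (p q : R) (g h : nat -> R -> R) :
  a < b -> (1 <= N)%nat -> bcont a b N g -> bcont a b N h ->
  bint a b N (fun j x => p * g j x + q * h j x) = p * bint a b N g + q * bint a b N h.
Proof.
intros Hab HN Cg Ch. unfold bint. rewrite <- sum_n_lin. apply sum_n_ext_loc. intros j Hj.
apply is_RInt_unique.
apply (is_RInt_plus (V := R_NormedModule)); apply (is_RInt_scal (V := R_NormedModule));
apply (RInt_correct (V := R_CompleteNormedModule)); apply bcont_ex_RInt; auto; lia.
Qed.

Lemma bcont_lin (a b : R) (N : nat) (p q : R) (g h : nat -> R -> R) : bcont a b N g -> bcont a b N h ->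
  bcont a b N (fun j x => p * g j x + q * h j x).
Proof.
intros Cg Ch j x Hj Hx.
apply (continuous_plus (V := R_NormedModule)); apply (continuous_scal_r (V := R_NormedModule)); auto.
Qed.

Lemma bcont_Cmod2 (a b : R) (N : nat) (g : bfun) :
  (forall j, (j < N)%nat -> ccont (g j) (node a b N j) (node a b N (S j))) ->
  bcont a b N (fun j x => Cmod (g j x) ^ 2).
Proof. intros H j x Hj Hx. exact (continuous_Cmod2 (g j) _ _ (H j Hj) x Hx). Qed.

Lemma bint_ge_0 (a b : R) (N : nat) (g : nat -> R -> R) :
  a < b -> (1 <= N)%nat -> bcont a b N g ->
  (forall j x, (j < N)%nat -> node a b N j <= x <= node a b N (S j) -> 0 <= g j x) ->
  0 <= bint a b N g.
Proof.
intros Hab HN Cg H. replace 0 with (bint a b N (fun j x => 0 * g j x + 0 * g j x)).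
- apply bint_le; auto.
  + now apply bcont_lin.
  + intros j x Hj Hx. specialize (H j x Hj Hx). lra.
- rewrite bint_lin by auto. ring.
Qed.

Lemma L2norm_sqr (a b : R) (N : nat) (g : bfun) :
  a < b -> (1 <= N)%nat ->
  (forall j, (j < N)%nat -> ccont (g j) (node a b N j) (node a b N (S j))) ->
  L2norm a b N g ^ 2 = bint a b N (fun j x => Cmod (g j x) ^ 2).
Proof.
intros Hab HN H. unfold L2norm. apply pow2_sqrt. apply bint_ge_0; auto.
- apply (bcont_Cmod2 a b N g); auto.
- intros. apply pow2_ge_0.
Qed.

(** A pointwise substitute for the triangle inequality of the L2 norm; the lost factor only affects
    the final constant. *)
Lemma L2norm_plus_sqr (a b : R) (N : nat) (g h : bfun) :
  a < b -> (1 <= N)%nat ->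
  (forall j, (j < N)%nat -> ccont (g j) (node a b N j) (node a b N (S j))) ->
  (forall j, (j < N)%nat -> ccont (h j) (node a b N j) (node a b N (S j))) ->
  L2norm a b N (fun j x => (g j x + h j x)%C) ^ 2 <=
  2 * L2norm a b N g ^ 2 + 2 * L2norm a b N h ^ 2.
Proof.
intros Hab HN Cg Ch. rewrite !L2norm_sqr; auto.
2:{ intros j Hj. apply ccont_plus; auto. }
rewrite <- bint_lin by (auto; now apply bcont_Cmod2).
apply bint_le; auto.
- apply (bcont_Cmod2 a b N (fun j x => (g j x + h j x)%C)). intros j Hj. apply ccont_plus; auto.
- apply bcont_lin; now apply bcont_Cmod2.
- intros j x _ _. generalize (Cmod_triangle (g j x) (h j x)) (Cmod_ge_0 (g j x + h j x)%C).
  generalize (Cmod_ge_0 (g j x)) (Cmod_ge_0 (h j x)).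
  generalize (Cmod (g j x)) (Cmod (h j x)) (Cmod (g j x + h j x)%C). intros p q S Hp Hq Htri HS.
  generalize (pow_incr S (p + q) 2 (conj HS Htri)) (pow2_ge_0 (p - q)). lra.
Qed.


Lemma L2norm_ge_0 (a b : R) (N : nat) (g : bfun) : 0 <= L2norm a b N g.
Proof. apply sqrt_pos. Qed.

Lemma Re_mult_conj_bound (z w : C) : - (Cmod z ^ 2 + Cmod w ^ 2) <= 2 * Re (z * Cconj w)%C.
Proof.
assert (H := re_le_Cmod (z * Cconj w)%C). rewrite Cmod_mult, Cmod_conj in H.
revert H. unfold Rabs. destruct (Rcase_abs (Re (z * Cconj w)%C));
generalize (pow2_ge_0 (Cmod z - Cmod w)) (pow2_ge_0 (Cmod z + Cmod w)); nra.
Qed.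

(** With p the projection error and e = P - U, Young's inequality turns 2L(|p||e| + |e|^2) into
    L|p|^2 + 3L|e|^2, and the pairing of e with the time derivative of p adds one more |e|^2; hence
    1 + 3L. *)
Lemma energy_inequality (a b : R) (k N : nat) (al1 be1 be2 M B : R) (f : R -> R) (K : Rbar)
  (g gt g' g'' : R -> C) (P U dP dU : Vh) :
  a < b -> (1 <= k)%nat -> (1 <= N)%nat -> (forall x, g (x + (b - a)) = g x) ->
  (forall x, is_derive (V := C_R_NormedModule) g x (g' x)) ->
  (forall x, is_derive (V := C_R_NormedModule) g' x (g'' x)) ->
  (forall l r, ccont g'' l r) -> (forall l r, ccont gt l r) ->
  W2inf_le K f M -> (forall x, Rbar_le (Cmod (g x) ^ 2) K) -> (forall x, Cmod (g x) <= B) ->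
  (forall j x, (j < N)%nat -> node a b N j <= x <= node a b N (S j) ->
     Rbar_le (Cmod (ev k U j x) ^ 2) K) ->
  (forall x, (Ci * gt x + g'' x + nlin f (g x) = 0)%C) ->
  proj_conditions a b k N al1 be1 be2 g (ev k P) ->
  (forall c j, (j < N)%nat ->
   let I h := CInt (fun x => (h x * pval k c x)%C) (node a b N j) (node a b N (S j)) in
   (Ci * I (ev k dU j) + dg_form a b N al1 be1 be2 (ev k U) (pval k c) j
    + I (fun x => nlin f (ev k U j x)) = 0)%C) ->
  let L := M * (1 + B * (3 * B + 3)) in
  bint a b N (fun j x => 2 * Re ((ev k dP j x - ev k dU j x) * Cconj (ev k P j x - ev k U j x))%C) <=
  bint a b N (fun j x => Cmod (gt x - ev k dP j x)%C ^ 2)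
  + L * bint a b N (fun j x => Cmod (g x - ev k P j x)%C ^ 2)
  + (1 + 3 * L) * bint a b N (fun j x => Cmod (ev k P j x - ev k U j x)%C ^ 2).
Proof.
intros Hab Hk HN Hp D1 D2 Cg'' Cgt HW HKg HB HKU NLS HP DG L.
set (e := fun (j : nat) (m : nat) => (P j m - U j m)%C).
assert (Ee : forall j x, (ev k P j x - ev k U j x)%C = ev k e j x).
{ intros j x. unfold e. now rewrite ev_minus. }
assert (Cg : forall l r, ccont g l r) by (intros; apply ccont_derive with g'; auto).
(* Integrand of the imaginary part of the error equation tested with conj e, without the space part:
   the factor i turns the imaginary part of the time term into a real part. *)
set (A := fun (j : nat) x => Re ((gt x - ev k dU j x) * Cconj (ev k e j x))%C
             + Im ((nlin f (g x) - nlin f (ev k U j x)) * Cconj (ev k e j x))%C).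
assert (C1 : forall j, ccont (fun x => ((gt x - ev k dU j x) * Cconj (ev k e j x))%C) (node a b N j) (node a b N (S j))).
{ intros j. apply ccont_mult; [apply ccont_minus; auto; apply ccont_pval|apply ccont_conj, ccont_pval]. }
assert (C2 : forall j, (j < N)%nat -> ccont (fun x => ((nlin f (g x) - nlin f (ev k U j x)) * Cconj (ev k e j x))%C)
   (node a b N j) (node a b N (S j))).
{ intros j Hj. apply ccont_mult; [|apply ccont_conj, ccont_pval].
  apply ccont_minus; apply ccont_nlin with K M; auto; apply ccont_pval. }
assert (CA : bcont a b N A).
{ intros j x Hj Hx. apply (continuous_plus (V := R_NormedModule)); [apply (C1 j x Hx)|apply (C2 j Hj x Hx)]. }
assert (HA : bint a b N A = 0).
{ rewrite <- (dg_form_real a b k N al1 be1 be2 e Hab HN).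
  assert (HA : forall j, (j < N)%nat -> RInt (A j) (node a b N j) (node a b N (S j)) =
     - Im (dg_form a b N al1 be1 be2 (ev k e) (pval k (fun m => Cconj (e j m))) j)).
  { intros j Hj. assert (Hn := node_lt a b N j Hab HN).
    assert (E := error_equation a b k N al1 be1 be2 M f K g gt g' g'' P U dU (fun m => Cconj (e j m)) j
      Hab Hk Hj Hp D1 D2 Cg'' Cgt HW HKg (fun x => HKU j x Hj) NLS HP (DG _ j Hj)).
    cbv beta zeta in E. fold e in E.
    assert (Ev : forall h : R -> C, (fun x => (h x * pval k (fun m => Cconj (e j m)) x)%C) =
      (fun x => (h x * Cconj (ev k e j x))%C)).
    { intros h. apply functional_extensionality. intros x. now rewrite pval_conj. }
    rewrite (Ev (fun x => (gt x - ev k dU j x)%C)), (Ev (fun x => (nlin f (g x) - nlin f (ev k U j x))%C)) in E.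
    apply (f_equal Im) in E.
    change (Im 0%C) with 0 in E.
    replace (RInt (A j) (node a b N j) (node a b N (S j))) with
      (Re (CInt (fun x => ((gt x - ev k dU j x) * Cconj (ev k e j x))%C) (node a b N j) (node a b N (S j)))
      + Im (CInt (fun x => ((nlin f (g x) - nlin f (ev k U j x)) * Cconj (ev k e j x))%C) (node a b N j) (node a b N (S j)))).
    - revert E.
      generalize (dg_form a b N al1 be1 be2 (ev k e) (pval k (fun m => Cconj (e j m))) j).
      generalize (CInt (fun x => ((gt x - ev k dU j x) * Cconj (ev k e j x))%C) (node a b N j) (node a b N (S j))).
      generalize (CInt (fun x => ((nlin f (g x) - nlin f (ev k U j x)) * Cconj (ev k e j x))%C) (node a b N j) (node a b N (S j))).
      intros [] [] []. unfold Re, Im; simpl. lra.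
    - rewrite Re_CInt, Im_CInt by (auto; lra). symmetry. apply is_RInt_unique.
      apply (is_RInt_plus (V := R_NormedModule)); apply (RInt_correct (V := R_CompleteNormedModule));
      apply ex_RInt_cont; try lra; intros x Hx; [apply (C1 j x Hx)|apply (C2 j Hj x Hx)]. }
  unfold bint. rewrite (sum_n_ext_loc _ (fun j => -1 * Im (dg_form a b N al1 be1 be2 (ev k e) (pval k (fun m => Cconj (e j m))) j)
    + 0 * 0)).
  2:{ intros j Hj. rewrite HA by lia. match goal with |- ?x = ?y => change (x = y :> R) end. ring. }
  rewrite (sum_n_lin (-1) 0 _ (fun _ => 0)).
  rewrite (dg_form_real a b k N al1 be1 be2 e Hab HN). ring. }
assert (CR : bcont a b N (fun j x => 2 * Re ((ev k dP j x - ev k dU j x) * Cconj (ev k P j x - ev k U j x))%C)).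
{ intros j x Hj Hx. apply (continuous_scal_r (V := R_NormedModule)).
  assert (C3 : ccont (fun x => ((ev k dP j x - ev k dU j x) * Cconj (ev k P j x - ev k U j x))%C)
    (node a b N j) (node a b N (S j))).
  { apply ccont_mult; [|apply ccont_conj]; apply ccont_minus; apply ccont_pval. }
  apply (C3 x Hx). }
assert (Cdt : bcont a b N (fun j x => Cmod (gt x - ev k dP j x)%C ^ 2)).
{ apply (bcont_Cmod2 a b N (fun j x => (gt x - ev k dP j x)%C)). intros j Hj. apply ccont_minus; auto; apply ccont_pval. }
assert (Ceps : bcont a b N (fun j x => Cmod (g x - ev k P j x)%C ^ 2)).
{ apply (bcont_Cmod2 a b N (fun j x => (g x - ev k P j x)%C)). intros j Hj. apply ccont_minus; auto; apply ccont_pval. }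
assert (Cerr : bcont a b N (fun j x => Cmod (ev k P j x - ev k U j x)%C ^ 2)).
{ apply (bcont_Cmod2 a b N (fun j x => (ev k P j x - ev k U j x)%C)). intros j Hj. apply ccont_minus; apply ccont_pval. }
(* The claim holds pointwise once [2 * A] is added on the right, and [A] has integral 0. *)
set (G1 := fun j x => 2 * A j x + 1 * Cmod (gt x - ev k dP j x)%C ^ 2).
set (G2 := fun j x => L * Cmod (g x - ev k P j x)%C ^ 2 + (1 + 3 * L) * Cmod (ev k P j x - ev k U j x)%C ^ 2).
assert (CG1 : bcont a b N G1) by now apply bcont_lin.
assert (CG2 : bcont a b N G2) by now apply bcont_lin.
apply Rle_trans with (bint a b N (fun j x => 1 * G1 j x + 1 * G2 j x)).
- apply bint_le; auto; [now apply bcont_lin|].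
  intros j x Hj Hx. unfold G1, G2, A. rewrite !Ee.
  assert (HL := nlin_energy f K M B (g x) (ev k U j x) (g x - ev k P j x)%C (ev k e j x) HW (HKg x) (HKU j x Hj Hx) (HB x)).
  assert (Q : (g x - ev k U j x)%C = (g x - ev k P j x + ev k e j x)%C) by (rewrite <- Ee; ring).
  specialize (HL Q). fold L in HL.
  assert (Y := Re_mult_conj_bound (gt x - ev k dP j x)%C (ev k e j x)).
  assert (Sp : Re ((gt x - ev k dU j x) * Cconj (ev k e j x))%C =
     Re ((gt x - ev k dP j x) * Cconj (ev k e j x))%C + Re ((ev k dP j x - ev k dU j x) * Cconj (ev k e j x))%C).
  { unfold Re; simpl; ring. }
  rewrite Sp.
  assert (HL0 : 0 <= L).
  { unfold L. assert (0 <= M).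
    { destruct (HW _ (pow2_ge_0 _) (HKg x) 0%nat) as [_ AA]; [lia|].
      eapply Rle_trans; [apply Rabs_pos|exact AA]. }
    assert (0 <= B) by (eapply Rle_trans; [apply Cmod_ge_0|exact (HB x)]).
    apply Rmult_le_pos; auto. assert (0 <= B * (3 * B + 3)) by (apply Rmult_le_pos; lra). lra. }
  assert (Y2 : 0 <= L * (Cmod (g x - ev k P j x)%C - Cmod (ev k e j x)) ^ 2).
  { apply Rmult_le_pos; auto. apply pow2_ge_0. }
  assert (HL' := Rle_trans _ _ _ (Rle_abs (- _)) (Rle_trans _ _ _ (Req_le _ _ (Rabs_Ropp _)) HL)).
  nra.
- rewrite bint_lin by auto. unfold G1, G2. rewrite !bint_lin by auto. rewrite HA. right. ring.
Qed.

(** * Time derivative of the energy and Gronwall's inequality *)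

(** Differentiation under the integral bundled with continuity in x, so that it is stable under
    sums. The squared modulus of a polynomial expands into products of a function of time and a
    power of x, for which the claim is immediate. *)
Definition int_diff (l r : R) (g : R -> R -> R) (g' : R -> R) (t : R) : Prop :=
  (forall s x, continuous (g s) x) /\ (forall x, continuous g' x) /\
  is_derive (fun s => RInt (g s) l r) t (RInt g' l r).

Lemma int_diff_plus (l r t : R) (g h : R -> R -> R) (g' h' : R -> R) : l <= r ->
  int_diff l r g g' t -> int_diff l r h h' t ->
  int_diff l r (fun s x => g s x + h s x) (fun x => g' x + h' x) t.
Proof.
intros Hlr [A [B D]] [A' [B' D']].
assert (E : forall p q : R -> R, (forall x, continuous p x) -> (forall x, continuous q x) ->
   RInt (fun x => p x + q x) l r = RInt p l r + RInt q l r).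
{ intros p q Cp Cq. apply is_RInt_unique. apply (is_RInt_plus (V := R_NormedModule));
  apply (RInt_correct (V := R_CompleteNormedModule)); apply ex_RInt_cont; auto. }
split; [|split].
- intros s x. apply (continuous_plus (V := R_NormedModule)); auto.
- intros x. apply (continuous_plus (V := R_NormedModule)); auto.
- rewrite E by auto.
  apply is_derive_ext with (fun s => plus (RInt (g s) l r) (RInt (h s) l r)).
  + intros s. symmetry. apply E; auto.
  + now apply (is_derive_plus (V := R_NormedModule)).
Qed.

Lemma int_diff_separated (l r t : R) (p : R -> R) (p' : R) (phi : R -> R) : l <= r ->
  is_derive p t p' -> (forall x, continuous phi x) ->
  int_diff l r (fun s x => p s * phi x) (fun x => p' * phi x) t.
Proof.
intros Hlr Hp Hphi.
assert (E : forall q : R, RInt (fun x => q * phi x) l r = q * RInt phi l r).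
{ intros q. apply is_RInt_unique. apply (is_RInt_scal (V := R_NormedModule)).
  apply (RInt_correct (V := R_CompleteNormedModule)); apply ex_RInt_cont; auto. }
split; [|split].
- intros s x. apply (continuous_scal_r (V := R_NormedModule)); auto.
- intros x. apply (continuous_scal_r (V := R_NormedModule)); auto.
- rewrite E. apply is_derive_ext with (fun s => p s * RInt phi l r).
  + intros s. symmetry. apply E.
  + apply (is_derive_scal_l (V := R_NormedModule)), Hp.
Qed.

Lemma int_diff_sum (l r t : R) (g : nat -> R -> R -> R) (g' : nat -> R -> R) (n : nat) : l <= r ->
  (forall m, (m <= n)%nat -> int_diff l r (g m) (g' m) t) ->
  int_diff l r (fun s x => sum_n (fun m => g m s x) n) (fun x => sum_n (fun m => g' m x) n) t.
Proof.
intros Hlr. induction n as [|n IH]; intros H.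
- replace (fun s x => sum_n (fun m => g m s x) 0) with (g 0%nat).
  2:{ apply functional_extensionality; intros s; apply functional_extensionality; intros x. now rewrite sum_O. }
  replace (fun x => sum_n (fun m => g' m x) 0) with (g' 0%nat).
  2:{ apply functional_extensionality; intros x. now rewrite sum_O. }
  apply H. lia.
- replace (fun s x => sum_n (fun m => g m s x) (S n)) with (fun s x => sum_n (fun m => g m s x) n + g (S n) s x).
  2:{ apply functional_extensionality; intros s; apply functional_extensionality; intros x. now rewrite sum_n_S_R. }
  replace (fun x => sum_n (fun m => g' m x) (S n)) with (fun x => sum_n (fun m => g' m x) n + g' (S n) x).
  2:{ apply functional_extensionality; intros x. now rewrite sum_n_S_R. }
  apply int_diff_plus; auto.
Qed.

Lemma sum_n_mult_sum_n (p q : nat -> R) (n : nat) :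
  sum_n p n * sum_n q n = sum_n (fun i => sum_n (fun m => p i * q m) n) n.
Proof.
rewrite (sum_n_ext (fun i => sum_n (fun m => p i * q m) n) (fun i => p i * sum_n q n)).
- symmetry. apply (sum_n_mult_r (K := R_Ring)).
- intros i. apply (sum_n_mult_l (K := R_Ring)).
Qed.

Lemma int_diff_poly_sqr (l r t : R) (k : nat) (p : R -> nat -> R) (p' : nat -> R) : l <= r ->
  (forall m, (m <= k)%nat -> is_derive (fun s => p s m) t (p' m)) ->
  int_diff l r (fun s x => sum_n (fun m => p s m * x ^ m) k ^ 2)
    (fun x => 2 * (sum_n (fun m => p' m * x ^ m) k * sum_n (fun m => p t m * x ^ m) k)) t.
Proof.
intros Hlr Hp.
replace (fun s x => sum_n (fun m => p s m * x ^ m) k ^ 2) with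
  (fun s x => sum_n (fun i => sum_n (fun m => (p s i * p s m) * x ^ (i + m)) k) k).
2:{ apply functional_extensionality; intros s; apply functional_extensionality; intros x.
    change (sum_n (fun m => p s m * x ^ m) k ^ 2) with
      (sum_n (fun m => p s m * x ^ m) k * (sum_n (fun m => p s m * x ^ m) k * 1)).
    rewrite Rmult_1_r, sum_n_mult_sum_n. apply sum_n_ext; intros i. apply sum_n_ext; intros m.
    rewrite pow_add. match goal with |- ?u = ?v => change (u = v :> R) end. ring. }
replace (fun x => 2 * (sum_n (fun m => p' m * x ^ m) k * sum_n (fun m => p t m * x ^ m) k)) with
  (fun x => sum_n (fun i => sum_n (fun m => (p' i * p t m + p t i * p' m) * x ^ (i + m)) k) k).
2:{ apply functional_extensionality; intros x.
    set (X := sum_n (fun m => p' m * x ^ m) k). set (Y := sum_n (fun m => p t m * x ^ m) k).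
    replace (2 * (X * Y)) with (1 * (X * Y) + 1 * (Y * X)) by ring. unfold X, Y.
    rewrite !sum_n_mult_sum_n, <- sum_n_lin. apply sum_n_ext; intros i.
    rewrite <- sum_n_lin. apply sum_n_ext; intros m.
    rewrite pow_add. match goal with |- ?u = ?v => change (u = v :> R) end. ring. }
apply int_diff_sum; auto. intros i Hi. apply int_diff_sum; auto. intros m Hm.
apply (int_diff_separated l r t (fun s => p s i * p s m) _ (fun x => x ^ (i + m))); auto.
- apply (is_derive_mult (K := R_AbsRing)); auto. intros; apply Rmult_comm.
- intros x. apply (ex_derive_continuous (K := R_AbsRing) (V := R_NormedModule)). auto_derive. auto.
Qed.

Lemma Re_pval (k : nat) (c : nat -> C) (x : R) : Re (pval k c x) = sum_n (fun m => Re (c m) * x ^ m) k.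
Proof.
induction k as [|k IH]; [rewrite pval_0, sum_O; simpl; now rewrite Rmult_1_r|].
rewrite pval_S, sum_n_S_R, <- IH. unfold Re; simpl. ring.
Qed.

Lemma Im_pval (k : nat) (c : nat -> C) (x : R) : Im (pval k c x) = sum_n (fun m => Im (c m) * x ^ m) k.
Proof.
induction k as [|k IH]; [rewrite pval_0, sum_O; simpl; now rewrite Rmult_1_r|].
rewrite pval_S, sum_n_S_R, <- IH. unfold Im; simpl. ring.
Qed.

Lemma is_derive_energy (a b : R) (k N : nat) (v : R -> Vh) (dv : Vh) (t : R) :
  a < b -> (1 <= N)%nat ->
  (forall j m, (j < N)%nat -> (m <= k)%nat ->
     is_derive (V := C_R_NormedModule) (fun s => v s j m) t (dv j m)) ->
  is_derive (fun s => bint a b N (fun j x => Cmod (ev k (v s) j x) ^ 2)) t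
    (bint a b N (fun j x => 2 * Re (ev k dv j x * Cconj (ev k (v t) j x))%C)).
Proof.
intros Hab HN H. unfold bint.
apply (is_derive_sum_n (V := R_NormedModule)
  (fun j s => RInt (fun x => Cmod (ev k (v s) j x) ^ 2) (node a b N j) (node a b N (S j)))).
intros j Hj. assert (Hn := node_lt a b N j Hab HN).
assert (Q : int_diff (node a b N j) (node a b N (S j)) (fun s x => Cmod (ev k (v s) j x) ^ 2)
  (fun x => 2 * Re (ev k dv j x * Cconj (ev k (v t) j x))%C) t); [|apply Q].
replace (fun s x => Cmod (ev k (v s) j x) ^ 2) with
  (fun s x => sum_n (fun m => Re (v s j m) * x ^ m) k ^ 2 + sum_n (fun m => Im (v s j m) * x ^ m) k ^ 2).
2:{ apply functional_extensionality; intros s; apply functional_extensionality; intros x.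
    rewrite <- Re_pval, <- Im_pval. symmetry. apply Cmod2_alt. }
replace (fun x => 2 * Re (ev k dv j x * Cconj (ev k (v t) j x))%C) with
  (fun x => 2 * (sum_n (fun m => Re (dv j m) * x ^ m) k * sum_n (fun m => Re (v t j m) * x ^ m) k)
          + 2 * (sum_n (fun m => Im (dv j m) * x ^ m) k * sum_n (fun m => Im (v t j m) * x ^ m) k)).
2:{ apply functional_extensionality; intros x.
    rewrite <- !Re_pval, <- !Im_pval. unfold ev, Re, Im; simpl. ring. }
apply int_diff_plus; [lra| |].
- apply (int_diff_poly_sqr _ _ t k (fun s m => Re (v s j m)) (fun m => Re (dv j m))); [lra|].
  intros m Hm. apply (proj1 (is_derive_C_iff _ _ _) (H j m ltac:(lia) Hm)).
- apply (int_diff_poly_sqr _ _ t k (fun s m => Im (v s j m)) (fun m => Im (dv j m))); [lra|].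
  intros m Hm. apply (proj1 (is_derive_C_iff _ _ _) (H j m ltac:(lia) Hm)).
Qed.

(** The function (E + A) exp(-c s) is nonincreasing: c >= 1 gives A <= c A, so the source term is
    absorbed without dividing by c. *)
Lemma gronwall (E E' : R -> R) (T c A : R) : 0 <= A -> 1 <= c -> 0 <= E 0 ->
  (forall t, 0 <= t <= T -> is_derive E t (E' t) /\ E' t <= c * E t + A) ->
  forall t, 0 <= t <= T -> E t <= exp (c * T) * (E 0 + A).
Proof.
intros HA Hc HE0 H t Ht.
set (F := fun s => (E s + A) * exp (- c * s)).
set (F' := fun s => (E' s - c * E s - c * A) * exp (- c * s)).
assert (HF : forall s, 0 <= s <= T -> is_derive F s (F' s)).
{ intros s Hs. destruct (H s Hs) as [D _].
  unfold F, F'. evar_last.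
  - apply (is_derive_mult (K := R_AbsRing) (fun s => E s + A) (fun s => exp (- c * s))).
    + apply (is_derive_plus (V := R_NormedModule)); [exact D|apply (is_derive_const (V := R_NormedModule))].
    + instantiate (1 := - c * exp (- c * s)). auto_derive; auto. ring.
    + intros; apply Rmult_comm.
  - unfold plus, mult, zero; simpl. ring. }
destruct (MVT_gen F 0 t F') as [x [Hx Ex]].
- intros x. rewrite Rmin_left, Rmax_right by lra. intros Hx. apply HF. lra.
- intros x. rewrite Rmin_left, Rmax_right by lra. intros Hx. apply continuity_pt_filterlim.
  apply (ex_derive_continuous (K := R_AbsRing) (V := R_NormedModule)). eexists. apply HF. lra.
- rewrite Rmin_left, Rmax_right in Hx by lra.
  assert (F' x <= 0).
  { unfold F'. destruct (H x) as [_ Q]; [lra|].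
    assert (0 < exp (- c * x)) by apply exp_pos.
    assert (0 <= (c - 1) * A) by (apply Rmult_le_pos; lra).
    assert (E' x - c * E x - c * A <= 0) by lra. nra. }
  assert (Ft : F t <= F 0) by nra.
  unfold F in Ft. rewrite Rmult_0_r, exp_0, Rmult_1_r in Ft.
  assert (Hexp : exp (- c * t) * exp (c * t) = 1).
  { rewrite <- exp_plus. replace (- c * t + c * t) with 0 by ring. apply exp_0. }
  assert (0 < exp (c * t)) by apply exp_pos.
  assert (E t + A <= (E 0 + A) * exp (c * t)).
  { replace (E t + A) with ((E t + A) * exp (- c * t) * exp (c * t)) by (rewrite Rmult_assoc, Hexp; ring).
    apply Rmult_le_compat_r; lra. }
  assert (exp (c * t) <= exp (c * T)).
  { destruct (Req_dec t T) as [->|]; [lra|]. left. apply exp_increasing. apply Rmult_lt_compat_l; lra. }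
  assert ((E 0 + A) * exp (c * t) <= (E 0 + A) * exp (c * T)) by (apply Rmult_le_compat_l; lra).
  lra.
Qed.

(** * Differentiability in time of the projection *)

(** The Taylor remainder is bounded uniformly in x, so its integral against [phi] is again quadratic
    in s - t, with constant (r - l) B W. *)
Lemma is_dt_CInt (T l r B W t : R) (g g' : R -> R -> C) (phi : R -> C) :
  l <= r -> 0 <= t <= T ->
  (forall s x, 0 <= s <= T -> Cmod (g s x - g t x - RtoC (s - t) * g' t x)%C <= B * (s - t) ^ 2) ->
  (forall s, 0 <= s <= T -> ccont (g s) l r) -> ccont (g' t) l r ->
  ccont phi l r -> (forall x, l <= x <= r -> Cmod (phi x) <= W) ->
  is_dt T (fun s => CInt (fun x => (g s x * phi x)%C) l r) t (CInt (fun x => (g' t x * phi x)%C) l r).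
Proof.
intros Hlr Ht Hq Cg Cg' Cphi HW.
apply is_dt_quadratic with ((r - l) * (B * W)); auto. intros s Hs.
assert (C1 : ccont (fun x => (g s x * phi x)%C) l r) by (apply ccont_mult; auto).
assert (C2 : ccont (fun x => (g t x * phi x)%C) l r) by (apply ccont_mult; auto).
assert (C3 : ccont (fun x => (g' t x * phi x)%C) l r) by (apply ccont_mult; auto).
assert (C4 : ccont (fun x => (RtoC (s - t) * (g' t x * phi x))%C) l r) by (apply ccont_mult; auto; apply ccont_const).
assert (C5 : ccont (fun x => (g s x * phi x - g t x * phi x)%C) l r) by (apply ccont_minus; auto).
rewrite <- CInt_scal, <- CInt_minus, <- CInt_minus by auto.
rewrite <- norm_C_R, Rmult_assoc.
apply (norm_RInt_le_const (V := C_R_NormedModule)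
  (fun x => (g s x * phi x - g t x * phi x - RtoC (s - t) * (g' t x * phi x))%C) l r); auto.
2:{ apply is_CInt; auto. now apply ccont_minus. }
intros x Hx. rewrite norm_C_R.
replace (g s x * phi x - g t x * phi x - RtoC (s - t) * (g' t x * phi x))%C with
  ((g s x - g t x - RtoC (s - t) * g' t x) * phi x)%C by ring.
rewrite Cmod_mult. replace (B * W * (s - t) ^ 2) with (B * (s - t) ^ 2 * W) by ring.
apply Rmult_le_compat; auto using Cmod_ge_0.
Qed.

Lemma CInt_mult_pval_eq0 (h : R -> C) (n : nat) (c : nat -> C) (l r : R) : l <= r -> ccont h l r ->
  (forall i, (i <= n)%nat -> CInt (fun x => (h x * RtoC (x ^ i))%C) l r = 0%C) ->
  CInt (fun x => (h x * pval n c x)%C) l r = 0%C.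
Proof.
intros Hlr Ch.
assert (Cm : forall i, ccont (fun x => RtoC (x ^ i)) l r).
{ intros i. apply ccont_RtoC. intros x _.
  apply (ex_derive_continuous (K := R_AbsRing) (V := R_NormedModule)). auto_derive. auto. }
assert (Hc : forall i, CInt (fun x => (h x * RtoC (x ^ i))%C) l r = 0%C ->
  CInt (fun x => (h x * (c i * RtoC (x ^ i)))%C) l r = 0%C).
{ intros i Hi. rewrite (CInt_ext _ (fun x => (c i * (h x * RtoC (x ^ i)))%C)) by (auto; intros; ring).
  rewrite CInt_scal, Hi; auto; [ring|]. now apply ccont_mult. }
induction n as [|n IH]; intros H.
- rewrite <- (Hc 0%nat (H 0%nat (le_n _))). apply CInt_ext; auto. intros x _.
  rewrite pval_0. simpl. ring.
- rewrite (CInt_ext _ (fun x => (h x * pval n c x + h x * (c (S n) * RtoC (x ^ S n)))%C)); auto.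
  2:{ intros x _. rewrite pval_S. ring. }
  rewrite CInt_plus; auto.
  + rewrite IH, Hc by auto. ring.
  + apply ccont_mult; auto. apply ccont_pval.
  + apply ccont_mult; auto. apply ccont_mult; auto. apply ccont_const.
Qed.

Lemma pval_monomial (n i : nat) (x : R) : (i <= n)%nat ->
  pval n (fun m => if Nat.eqb m i then RtoC 1 else RtoC 0) x = RtoC (x ^ i).
Proof.
intros Hi.
assert (Z : forall m, (m < i)%nat -> pval m (fun m => if Nat.eqb m i then RtoC 1 else RtoC 0) x = 0%C).
{ intros m Hm. transitivity (pval m (fun _ => RtoC 0) x).
  - apply pval_ext. intros p Hp. now rewrite (proj2 (Nat.eqb_neq p i)) by lia.
  - clear Hm. induction m as [|m IH]; [now rewrite pval_0|]. rewrite pval_S, IH. ring. }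
induction n as [|n IH].
- replace i with 0%nat by lia. now rewrite pval_0.
- rewrite pval_S. destruct (Nat.eqb_spec (S n) i) as [<-|Hn].
  + rewrite Z by lia. ring.
  + rewrite IH by lia. ring.
Qed.

(* The projection conditions are finitely many linear functionals with trivial
   common kernel, so each coefficient is a fixed linear combination of the data. *)
Lemma Pstar_differentiable (a b T : R) (k N : nat) (al1 be1 be2 : R) (B : R)
  (u : R -> R -> C) (D : nat -> nat -> R -> R -> C) (Pu : R -> Vh) :
  a < b -> (1 <= k)%nat -> (1 <= N)%nat -> 0 < T ->
  (forall t x, 0 <= t <= T -> D 0%nat 0%nat t x = u t x) ->
  (forall i j t x, (i + j < 3)%nat -> 0 <= t <= T ->
       is_dt T (fun s => D i j s x) t (D (S i) j t x) /\
       is_derive (V := C_R_NormedModule) (D i j t) x (D i (S j) t x)) ->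
  (forall i j t x, (i + j <= 3)%nat -> 0 <= t <= T -> Cmod (D i j t x) <= B) ->
  (forall t, 0 <= t <= T -> is_Pstar a b k N al1 be1 be2 (u t) (Pu t)) ->
  forall t j m, 0 <= t <= T -> (j < N)%nat -> (m <= k)%nat ->
  exists l, is_dt T (fun s => Pu s j m) t l.
Proof.
intros Hab Hk HN HT D0 HD HB HP t j0 m0 Ht Hj0 Hm0.
assert (EuD : forall s, 0 <= s <= T -> u s = D 0%nat 0%nat s).
{ intros s Hs. apply functional_extensionality. intros x. symmetry. now apply D0. }
set (vh := fun (v : nat * nat -> C) (j m : nat) => v (j, m)).
set (Lu := fun (j : nat) v => flux_u a b N al1 be2 (ev k (vh v)) (S j)).
set (Lux := fun (j : nat) v => flux_ux a b N al1 be1 (ev k (vh v)) (S j)).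
set (Lm := fun (j i : nat) v => CInt (fun x => (ev k (vh v) j x * RtoC (x ^ i))%C) (node a b N j) (node a b N (S j))).
(* Per cell two fluxes and the k - 1 moments against x^0, ..., x^(k-2): as many functionals as
   coefficients, and no moments when k = 1. *)
set (L := flat_map (fun j => Lu j :: Lux j :: map (Lm j) (List.seq 0 (k - 1))) (List.seq 0 N)).
assert (InL : forall lam, In lam L <-> exists j, (j < N)%nat /\
   (lam = Lu j \/ lam = Lux j \/ exists i, (i < k - 1)%nat /\ lam = Lm j i)).
{ intros lam. unfold L. rewrite in_flat_map. split.
  - intros [j [Hj Hl]]. apply in_seq in Hj. exists j. split; [lia|].
    destruct Hl as [<-|[<-|Hl]]; auto. right; right.
    apply in_map_iff in Hl. destruct Hl as [i [<- Hi]]. apply in_seq in Hi. exists i. split; [lia|auto].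
  - intros [j [Hj Hl]]. exists j. split; [apply in_seq; lia|].
    destruct Hl as [->|[->|[i [Hi ->]]]]; [now left|right; now left|right; right].
    apply in_map. apply in_seq. lia. }
set (Q := fun lam : (nat * nat -> C) -> C =>
   exists l, is_dt T (fun s => lam (fun p => Pu s (fst p) (snd p))) t l).
assert (Cm : forall i l r, ccont (fun x => RtoC (x ^ i)) l r).
{ intros i l r. apply ccont_RtoC. intros x _.
  apply (ex_derive_continuous (K := R_AbsRing) (V := R_NormedModule)). auto_derive. auto. }
apply (functional_in_span Q) with (L := L) (phi := fun v => v (j0, m0)).
- exists 0%C. now apply is_dt_const.
- intros g h c [l Hl] [l' Hl']. exists (l + c * l')%C. now apply is_dt_lin.
- intros lam Hlam. apply InL in Hlam. destruct Hlam as [j [Hj Hl]].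
  assert (Hn := node_lt a b N j Hab HN).
  destruct Hl as [->|[->|[i [Hi ->]]]]; split.
  + intros v w c. unfold Lu. rewrite <- flux_u_lin. reflexivity.
  + exists (D 1%nat 0%nat t (node a b N (S j))).
    apply (is_dt_ext T (fun s => D 0%nat 0%nat s (node a b N (S j)))); auto; [|apply HD; auto; lia].
    intros s Hs. rewrite D0 by auto. symmetry. apply (proj1 (HP s Hs)), Hj.
  + intros v w c. unfold Lux. rewrite <- flux_ux_lin. reflexivity.
  + exists (D 1%nat 1%nat t (node a b N (S j))).
    apply (is_dt_ext T (fun s => D 0%nat 1%nat s (node a b N (S j)))); auto; [|apply HD; auto; lia].
    intros s Hs. symmetry.
    transitivity (Dx (u s) (node a b N (S j))); [apply (proj1 (HP s Hs)), Hj|].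
    apply Dx_unique. rewrite EuD by auto. apply HD; auto; lia.
  + intros v w c. unfold Lm.
    assert (Cv : forall z, ccont (fun x => (ev k (vh z) j x * RtoC (x ^ i))%C) (node a b N j) (node a b N (S j))).
    { intros z. apply ccont_mult; [apply ccont_pval|apply Cm]. }
    rewrite <- CInt_scal, <- CInt_plus; auto; try lra.
    2:{ apply ccont_mult; [apply ccont_const|apply Cv]. }
    apply CInt_ext; [lra|]. intros x _. unfold vh, ev.
    rewrite (pval_lin k (fun m => v (j, m)) (fun m => w (j, m)) c). ring.
  + exists (CInt (fun x => (D 1%nat 0%nat t x * RtoC (x ^ i))%C) (node a b N j) (node a b N (S j))).
    apply (is_dt_ext T (fun s => CInt (fun x => (D 0%nat 0%nat s x * RtoC (x ^ i))%C) (node a b N j) (node a b N (S j)))); auto.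
    * intros s Hs. unfold Lm. symmetry.
      assert (E := proj1 (proj1 (HP s Hs) j Hj) ltac:(lia) (fun m => if Nat.eqb m i then RtoC 1 else RtoC 0)).
      rewrite EuD in E by auto.
      assert (EE : (fun x => pval (k - 2) (fun m => if Nat.eqb m i then RtoC 1 else RtoC 0) x) = (fun x => RtoC (x ^ i))).
      { apply functional_extensionality. intros x. apply pval_monomial. lia. }
      change (pval (k - 2) (fun m => if Nat.eqb m i then RtoC 1 else RtoC 0) = fun x => RtoC (x ^ i)) in EE.
      rewrite EE in E. exact E.
    (* [4 * B] is the Taylor constant in time; the other constant bounds |x^i| on the cell. *)
    * apply (is_dt_CInt T _ _ (4 * B) (Rmax (Rabs (node a b N j)) (Rabs (node a b N (S j))) ^ i) t (D 0%nat 0%nat) (D 1%nat 0%nat)); auto; try lra.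
      -- intros s x Hs.
         apply (is_dt_taylor T (fun s => D 0%nat 0%nat s x) (fun s => D 1%nat 0%nat s x) (fun s => D 2%nat 0%nat s x)); auto.
         ++ intros r Hr. apply HD; auto; lia.
         ++ intros r Hr. apply HD; auto; lia.
      -- intros s Hs. apply ccont_derive with (D 0%nat 1%nat s). intros x _. apply HD; auto; lia.
      -- apply ccont_derive with (D 1%nat 1%nat t). intros x _. apply HD; auto; lia.
      -- intros x Hx. rewrite Cmod_R, <- RPow_abs. apply pow_incr. split; [apply Rabs_pos|].
         apply RmaxAbs; lra.
- intros v w c. reflexivity.
- intros v Hv.
  assert (HvL : forall j, (j < N)%nat -> Lu j v = 0%C /\ Lux j v = 0%C /\
     forall i, (i < k - 1)%nat -> Lm j i v = 0%C).
  { intros j Hj. split; [|split].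
    - apply Hv, InL. exists j. auto.
    - apply Hv, InL. exists j. auto.
    - intros i Hi. apply Hv, InL. exists j. split; auto. right; right. exists i. auto. }
  destruct (HP t Ht) as [HPt Huniq].
  (* Adding an element of the common kernel yields a second solution of the projection conditions;
     uniqueness forces that element to vanish on each cell. *)
  set (P' := fun j m => (Pu t j m + 1 * vh v j m)%C).
  assert (HP' : proj_conditions a b k N al1 be1 be2 (u t) (ev k P')).
  { intros j Hj. destruct (HvL j Hj) as [V1 [V2 V3]]. destruct (HPt j Hj) as [W1 [W2 W3]].
    assert (Hn := node_lt a b N j Hab HN).
    split; [|split].
    - intros Hk2 c. rewrite <- W1 by auto.
      rewrite (CInt_ext _ (fun x => (ev k (Pu t) j x * pval (k - 2) c x + ev k (vh v) j x * pval (k - 2) c x)%C)).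
      2:{ lra. }
      2:{ intros x _. unfold P', ev. rewrite pval_lin. ring. }
      rewrite CInt_plus; try lra; try (apply ccont_mult; apply ccont_pval).
      rewrite (CInt_mult_pval_eq0 (ev k (vh v) j)); try lra.
      + ring.
      + apply ccont_pval.
      + intros i Hi. apply V3. lia.
    - unfold P'. rewrite flux_u_lin, W2. unfold Lu in V1. rewrite V1. ring.
    - unfold P'. rewrite flux_ux_lin, W3. unfold Lux in V2. rewrite V2. ring. }
  change (v (j0, m0)) with (vh v j0 m0).
  apply (pval_eq0_coef k (vh v j0) (node a b N j0) (node a b N (S j0))); auto.
  + now apply node_lt.
  + intros x Hx.
    assert (E := Huniq P' HP' j0 x Hj0 ltac:(lra)).
    unfold P', ev in E. rewrite pval_lin in E.
    replace (pval k (vh v j0) x) with (pval k (Pu t j0) x + 1 * pval k (vh v j0) x - pval k (Pu t j0) x)%C by ring.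
    rewrite E. ring.
Qed.

(** * The error estimate *)

Lemma is_dt_pval (T t x : R) (k : nat) (c : R -> nat -> C) (dc : nat -> C) : 0 <= t <= T ->
  (forall m, (m <= k)%nat -> is_dt T (fun s => c s m) t (dc m)) ->
  is_dt T (fun s => pval k (c s) x) t (pval k dc x).
Proof.
intros Ht. induction k as [|k IH]; intros H.
- rewrite pval_0. apply (is_dt_ext T (fun s => c s 0%nat)); auto. intros s _. now rewrite pval_0.
- rewrite pval_S. apply (is_dt_ext T (fun s => (pval k (c s) x + RtoC (x ^ S k) * c s (S k))%C)); auto.
  + intros s _. rewrite pval_S. ring.
  + replace (pval k dc x + dc (S k) * RtoC (x ^ S k))%C with (pval k dc x + RtoC (x ^ S k) * dc (S k))%C by ring.
    apply is_dt_lin; auto.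
Qed.

Lemma L2norm_ext (a b : R) (N : nat) (g h : bfun) : a < b -> (1 <= N)%nat ->
  (forall j x, (j < N)%nat -> node a b N j <= x <= node a b N (S j) -> g j x = h j x) ->
  L2norm a b N g = L2norm a b N h.
Proof.
intros Hab HN H. unfold L2norm. f_equal. apply sum_n_ext_loc. intros j Hj.
assert (Hn := node_lt a b N j Hab HN).
apply RInt_ext. rewrite Rmin_left, Rmax_right by lra. intros x Hx. rewrite H; [reflexivity|lia|lra].
Qed.

Lemma sup_time_ub (T : R) (g : R -> R) (t : R) : 0 <= t <= T -> Rbar_le (g t) (sup_time T g).
Proof. intros Ht. apply (proj1 (Lub_Rbar_correct _)). now exists t. Qed.

(** If a supremum is infinite the right-hand side is +oo, where c > 0 matters for the product;
    nonnegativity excludes -oo. Only finite suprema are left to treat. *)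
Lemma Rbar_estimate (c r z : R) (S1 S2 : Rbar) : 0 < c -> Rbar_le 0 S1 -> Rbar_le 0 S2 ->
  (forall s1 s2 : R, S1 = s1 -> S2 = s2 -> r <= c * (z + s1 + s2)) ->
  Rbar_le r (Rbar_mult c (Rbar_plus (Rbar_plus z S1) S2)).
Proof.
intros Hc H1 H2 H.
assert (P : Rbar_mult c p_infty = p_infty).
{ unfold Rbar_mult; simpl. destruct (Rle_dec 0 c) as [Hle|]; [|lra].
  destruct (Rle_lt_or_eq_dec 0 c Hle); [reflexivity|lra]. }
destruct S1 as [s1| |]; [|destruct S2 as [s2| |]|]; try contradiction.
- destruct S2 as [s2| |]; try contradiction.
  + now apply H.
  + change (Rbar_le r (Rbar_mult c p_infty)). now rewrite P.
- change (Rbar_le r (Rbar_mult c p_infty)). now rewrite P.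
- change (Rbar_le r (Rbar_mult c p_infty)). now rewrite P.
Qed.

Theorem theorem3p10 :
  forall (k : nat) (a b T M C1 : R) (u : R -> R -> C),
  (1 <= k)%nat -> a < b -> 0 < T ->
  (forall t x, 0 <= t <= T -> u t (x + (b - a)) = u t x) ->
  smooth_bounded 3 T u ->
  exists Cstar : R, 0 < Cstar /\
  forall (f : R -> R) (K : Rbar),
  W2inf_le K f M ->
  smooth_bounded 3 T (fun t x => RtoC (f (Cmod (u t x) ^ 2))) ->
  nls_solution T f u ->
  (forall t x, 0 <= t <= T -> Rbar_le (Cmod (u t x) ^ 2) K) ->
  forall (N : nat) (al1 be1 be2 : R),
  (1 <= N)%nat ->
  cond_a k (hmesh a b N) al1 be1 be2 \/ cond_b k N (hmesh a b N) al1 be1 be2 ->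
  forall (Pu : R -> Vh),
  (forall t, 0 <= t <= T -> is_Pstar a b k N al1 be1 be2 (u t) (Pu t)) ->
  let eps : R -> bfun := fun t j x => (u t x - ev k (Pu t) j x)%C in
  let eps_t : R -> bfun := fun t j x => Dt T (fun s => eps s j x) t in
  (forall t, 0 <= t <= T ->
     L2norm a b N (eps t) <= C1 * hmesh a b N /\
     Rbar_le (Linfnorm a b N (eps t)) (C1 * hmesh a b N)) ->
  forall (uh : R -> Vh),
  dg_solution a b T f k N al1 be1 be2 uh ->
  (forall t j x, 0 <= t <= T -> (j < N)%nat ->
     node a b N j <= x <= node a b N (S j) ->
     Rbar_le (Cmod (ev k (uh t) j x) ^ 2) K) ->
  let err : R -> bfun := fun t j x => (u t x - ev k (uh t) j x)%C in
  forall t, 0 <= t <= T ->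
  Rbar_le (L2norm a b N (err t))
    (Rbar_mult Cstar
      (Rbar_plus
        (Rbar_plus (L2norm a b N (err 0))
                   (sup_time T (fun s => L2norm a b N (eps_t s))))
        (sup_time T (fun s => L2norm a b N (eps s))))).
Proof.
intros k a b T M C1 u Hk Hab HT Hper [D [D0 [HD [B HB]]]].
(* The constant is chosen before [f], when the sign of [M] is not yet known; [HM] removes the
   absolute value once [f] is given. *)
set (L := Rabs M * (1 + B * (3 * B + 3))).
set (X := exp ((1 + 3 * L) * T)).
assert (HX0 : 0 < X) by apply exp_pos.
assert (HB0 : 0 <= B).
{ eapply Rle_trans; [apply Cmod_ge_0|apply (HB 0%nat 0%nat 0 0); [lia|lra]]. }
assert (HL0 : 0 <= L).
{ apply Rmult_le_pos; [apply Rabs_pos|]. assert (0 <= B * (3 * B + 3)) by (apply Rmult_le_pos; lra). lra. }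
assert (HX1 : 1 <= X).
{ rewrite <- exp_0. unfold X.
  assert (0 < (1 + 3 * L) * T) by (apply Rmult_lt_0_compat; lra). left. now apply exp_increasing. }
(* With Z the initial error and S1, S2 the suprema for eps_t and eps: ||err||^2 <= 2 S2^2 + 2 E(t),
   E(t) <= X (E(0) + S1^2 + L S2^2) and E(0) <= 2 Z^2 + 2 S2^2. Since X >= 1, the coefficients of
   Z^2, S1^2, S2^2 are at most 4X, 2X and (6 + 2L)X. *)
exists (sqrt (X * (6 + 2 * L))). split.
{ apply sqrt_lt_R0. apply Rmult_lt_0_compat; lra. }
intros f K HW _ NLS HK N al1 be1 be2 HN _ Pu HP eps eps_t _ uh [Huh DG] HKh err t Ht.
assert (EuD : forall s, 0 <= s <= T -> u s = D 0%nat 0%nat s).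
{ intros s Hs. apply functional_extensionality. intros x. symmetry. now apply D0. }
assert (HM : Rabs M = M).
{ apply Rabs_pos_eq. destruct (HW _ (pow2_ge_0 _) (HK 0 0 ltac:(lra)) 0%nat) as [_ A]; [lia|].
  eapply Rle_trans; [apply Rabs_pos|exact A]. }
assert (Du : forall s x, 0 <= s <= T -> is_dt T (fun r => u r x) s (D 1%nat 0%nat s x)).
{ intros s x Hs. apply (is_dt_ext T (fun r => D 0%nat 0%nat r x)); auto. apply HD; auto; lia. }
assert (Dux : forall s x, 0 <= s <= T -> is_derive (V := C_R_NormedModule) (u s) x (D 0%nat 1%nat s x)).
{ intros s x Hs. rewrite EuD by auto. apply HD; auto; lia. }
assert (Duxx : forall s x, 0 <= s <= T -> is_derive (V := C_R_NormedModule) (D 0%nat 1%nat s) x (D 0%nat 2%nat s x)).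
{ intros s x Hs. apply HD; auto; lia. }
assert (Cut : forall s l r, 0 <= s <= T -> ccont (D 1%nat 0%nat s) l r).
{ intros s l r Hs. apply ccont_derive with (D 1%nat 1%nat s). intros x _. apply HD; auto; lia. }
assert (Cuxx : forall s l r, 0 <= s <= T -> ccont (D 0%nat 2%nat s) l r).
{ intros s l r Hs. apply ccont_derive with (D 0%nat 3%nat s). intros x _. apply HD; auto; lia. }
assert (Cu : forall s l r, 0 <= s <= T -> ccont (u s) l r).
{ intros s l r Hs. apply ccont_derive with (D 0%nat 1%nat s). auto. }
assert (HPd := Pstar_differentiable a b T k N al1 be1 be2 B u D Pu Hab Hk HN HT D0 HD HB HP).
set (dP := fun s j m => Dt T (fun r => Pu r j m) s).
set (dU := fun s j m => Dt T (fun r => uh r j m) s).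
assert (HdP : forall s j m, 0 <= s <= T -> (j < N)%nat -> (m <= k)%nat ->
  is_dt T (fun r => Pu r j m) s (dP s j m)).
{ intros s j m Hs Hj Hm. destruct (HPd s j m Hs Hj Hm) as [l Hl].
  unfold dP. now rewrite (Dt_unique T _ s l). }
assert (HdU : forall s j m, 0 <= s <= T -> (j < N)%nat -> (m <= k)%nat ->
  is_dt T (fun r => uh r j m) s (dU s j m)).
{ intros s j m Hs Hj Hm. destruct (Huh s j m Hs Hj Hm) as [l Hl].
  unfold dU. now rewrite (Dt_unique T _ s l). }
set (e' := fun s j m => (dP s j m + (- (1)) * dU s j m)%C).
(* Coefficients of the discrete error, extended in time so that the energy is differentiable in the
   two-sided sense at 0 and T as well, as Gronwall's inequality requires. *)
set (e := fun s j m => affine_ext T (fun r => Pu r j m + (- (1)) * uh r j m)%C (fun r => e' r j m) s).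
assert (He : forall s j x, 0 <= s <= T -> ev k (e s) j x = (ev k (Pu s) j x - ev k (uh s) j x)%C).
{ intros s j x Hs. unfold ev.
  transitivity (pval k (fun m => (Pu s j m + (- (1)) * uh s j m)%C) x).
  - apply pval_ext. intros m _. unfold e. now rewrite affine_ext_eq.
  - rewrite pval_lin. ring. }
assert (He' : forall s j x, ev k (e' s) j x = (ev k (dP s) j x - ev k (dU s) j x)%C).
{ intros s j x. unfold ev, e'. rewrite pval_lin. ring. }
set (E := fun s => bint a b N (fun j x => Cmod (ev k (e s) j x) ^ 2)).
set (E' := fun s => bint a b N (fun j x => 2 * Re (ev k (e' s) j x * Cconj (ev k (e s) j x))%C)).
assert (DE : forall s, 0 <= s <= T -> is_derive E s (E' s)).
{ intros s Hs. apply (is_derive_energy a b k N e (e' s) s); auto. intros j m Hj Hm.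
  apply (is_derive_affine_ext T _ (fun r => e' r j m)); auto.
  intros r Hr. apply is_dt_lin; auto. }
assert (Heps_t : forall s, 0 <= s <= T ->
  L2norm a b N (eps_t s) = L2norm a b N (fun j x => (D 1%nat 0%nat s x - ev k (dP s) j x)%C)).
{ intros s Hs. apply L2norm_ext; auto. intros j x Hj _. unfold eps_t. apply Dt_unique; auto.
  apply (is_dt_ext T (fun r => (u r x + (- (1)) * ev k (Pu r) j x)%C)); auto.
  - intros r _. unfold eps. ring.
  - replace (D 1%nat 0%nat s x - ev k (dP s) j x)%C with (D 1%nat 0%nat s x + (- (1)) * ev k (dP s) j x)%C by ring.
    apply is_dt_lin; auto. apply is_dt_pval; auto. }
assert (EI : forall s, 0 <= s <= T ->
  E' s <= L2norm a b N (eps_t s) ^ 2 + L * L2norm a b N (eps s) ^ 2 + (1 + 3 * L) * E s).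
{ intros s Hs. rewrite Heps_t by auto.
  rewrite !L2norm_sqr; auto.
  2:{ intros j Hj. apply ccont_minus; [apply Cu; auto|apply ccont_pval]. }
  2:{ intros j Hj. apply ccont_minus; [apply Cut; auto|apply ccont_pval]. }
  unfold E', E.
  replace (fun j x => 2 * Re (ev k (e' s) j x * Cconj (ev k (e s) j x))%C) with
   (fun j x => 2 * Re ((ev k (dP s) j x - ev k (dU s) j x) * Cconj (ev k (Pu s) j x - ev k (uh s) j x))%C).
  2:{ apply functional_extensionality; intros j; apply functional_extensionality; intros x.
      now rewrite He, He'. }
  replace (fun j x => Cmod (ev k (e s) j x) ^ 2) with
   (fun j x => Cmod (ev k (Pu s) j x - ev k (uh s) j x)%C ^ 2).
  2:{ apply functional_extensionality; intros j; apply functional_extensionality; intros x.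
      now rewrite He. }
  unfold L. rewrite HM.
  apply (energy_inequality a b k N al1 be1 be2 M B f K (u s) (D 1%nat 0%nat s) (D 0%nat 1%nat s) (D 0%nat 2%nat s)); auto.
  - intros x. rewrite EuD by auto. apply HB; auto; lia.
  - intros x. unfold nlin.
    assert (Q := NLS s x Hs).
    rewrite (Dt_unique T _ s _ HT Hs (Du s x Hs)) in Q.
    replace (Dx (u s)) with (D 0%nat 1%nat s) in Q.
    2:{ apply functional_extensionality. intros y. symmetry. apply Dx_unique; auto. }
    rewrite (Dx_unique _ _ _ (Duxx s x Hs)) in Q. exact Q.
  - apply HP; auto.
  - intros c j Hj. cbv zeta. assert (Q := DG s Hs c j Hj). cbv zeta in Q.
    replace (fun x => (Dt T (fun r => ev k (uh r) j x) s * pval k c x)%C) with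
      (fun x => (ev k (dU s) j x * pval k c x)%C) in Q.
    2:{ apply functional_extensionality. intros x. f_equal. symmetry. apply Dt_unique; auto.
        apply is_dt_pval; auto. }
    rewrite <- Q. unfold dg_form, nlin. ring. }
apply Rbar_estimate.
- apply sqrt_lt_R0. apply Rmult_lt_0_compat; lra.
- apply Rbar_le_trans with (L2norm a b N (eps_t t)); [apply (L2norm_ge_0 a b N (eps_t t))|].
  apply (sup_time_ub T (fun s => L2norm a b N (eps_t s)) t Ht).
- apply Rbar_le_trans with (L2norm a b N (eps t)); [apply (L2norm_ge_0 a b N (eps t))|].
  apply (sup_time_ub T (fun s => L2norm a b N (eps s)) t Ht).
- intros S1 S2 HS1 HS2.
  assert (B1 : forall s, 0 <= s <= T -> 0 <= L2norm a b N (eps_t s) <= S1).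
  { intros s Hs. split; [apply L2norm_ge_0|].
    assert (Q := sup_time_ub T (fun s => L2norm a b N (eps_t s)) s Hs). rewrite HS1 in Q. exact Q. }
  assert (B2 : forall s, 0 <= s <= T -> 0 <= L2norm a b N (eps s) <= S2).
  { intros s Hs. split; [apply L2norm_ge_0|].
    assert (Q := sup_time_ub T (fun s => L2norm a b N (eps s)) s Hs). rewrite HS2 in Q. exact Q. }
  assert (EN : forall s, 0 <= s <= T -> E s = L2norm a b N (fun j x => ev k (e s) j x) ^ 2).
  { intros s Hs. rewrite L2norm_sqr; auto. intros j Hj. apply ccont_pval. }
  assert (Ceps : forall s, 0 <= s <= T -> forall j, ccont (eps s j) (node a b N j) (node a b N (S j))).
  { intros s Hs j. apply ccont_minus; [apply Cu; auto|apply ccont_pval]. }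
  assert (Cerr : forall s, 0 <= s <= T -> forall j, ccont (err s j) (node a b N j) (node a b N (S j))).
  { intros s Hs j. apply ccont_minus; [apply Cu; auto|apply ccont_pval]. }
  set (Z := L2norm a b N (err 0)).
  assert (HZ0 : 0 <= Z) by apply L2norm_ge_0.
  assert (H0T : 0 <= 0 <= T) by lra.
  (* At time 0 the discrete error is [err 0 - eps 0], and the supremum of the projection error
     includes t = 0. *)
  assert (R0 : E 0 <= 2 * Z ^ 2 + 2 * S2 ^ 2).
  { rewrite EN by auto.
    rewrite (L2norm_ext a b N _ (fun j x => (err 0 j x + (- (1)) * eps 0 j x)%C)) by
      (auto; intros j x _ _; rewrite He by auto; unfold err, eps; ring).
    eapply Rle_trans; [apply (L2norm_plus_sqr a b N (err 0) (fun j x => ((- (1)) * eps 0 j x)%C)); auto|].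
    - intros j Hj. apply ccont_mult; [apply ccont_const|auto].
    - replace (L2norm a b N (fun j x => ((- (1)) * eps 0 j x)%C)) with (L2norm a b N (eps 0)).
      + fold Z. assert (Q := pow_incr _ _ 2 (B2 0 H0T)). lra.
      + unfold L2norm. f_equal. apply sum_n_ext. intros j. apply RInt_ext. intros x _.
        rewrite Cmod_mult, Cmod_opp, Cmod_1. now rewrite Rmult_1_l. }
  assert (Rt : L2norm a b N (err t) ^ 2 <= 2 * S2 ^ 2 + 2 * E t).
  { rewrite EN by auto.
    rewrite (L2norm_ext a b N (err t) (fun j x => (eps t j x + ev k (e t) j x)%C)) by
      (auto; intros j x _ _; rewrite He by auto; unfold err, eps; ring).
    eapply Rle_trans; [apply (L2norm_plus_sqr a b N (eps t) (fun j x => ev k (e t) j x)); auto|].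
    - intros j Hj. apply ccont_pval.
    - assert (Q := pow_incr _ _ 2 (B2 t Ht)). lra. }
  assert (HS10 : 0 <= S1) by (destruct (B1 t Ht); lra).
  assert (HS20 : 0 <= S2) by (destruct (B2 t Ht); lra).
  assert (Gr : E t <= X * (E 0 + (S1 ^ 2 + L * S2 ^ 2))).
  { apply (gronwall E E'); auto.
    - generalize (pow2_ge_0 S1) (Rmult_le_pos _ _ HL0 (pow2_ge_0 S2)). lra.
    - lra.
    - rewrite EN by auto. apply pow2_ge_0.
    - intros s Hs. split; auto. eapply Rle_trans; [apply EI; auto|].
      assert (Q1 := pow_incr _ _ 2 (B1 s Hs)). assert (Q2 := pow_incr _ _ 2 (B2 s Hs)).
      assert (Q3 := Rmult_le_compat_l L _ _ HL0 Q2). lra. }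
  assert (Fin : L2norm a b N (err t) ^ 2 <= X * (6 + 2 * L) * (Z + S1 + S2) ^ 2).
  { assert (E t <= X * (2 * Z ^ 2 + 2 * S2 ^ 2 + (S1 ^ 2 + L * S2 ^ 2))).
    { eapply Rle_trans; [exact Gr|]. apply Rmult_le_compat_l; lra. }
    assert (S2 ^ 2 <= X * S2 ^ 2) by (generalize (pow2_ge_0 S2); nra).
    assert (Y1 : L2norm a b N (err t) ^ 2 <= X * (4 * Z ^ 2 + 2 * S1 ^ 2 + (6 + 2 * L) * S2 ^ 2)) by lra.
    eapply Rle_trans; [exact Y1|]. rewrite Rmult_assoc. apply Rmult_le_compat_l; [lra|].
    assert (0 <= Z * S1) by (now apply Rmult_le_pos).
    assert (0 <= Z * S2) by (now apply Rmult_le_pos).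
    assert (0 <= S1 * S2) by (now apply Rmult_le_pos).
    assert (Y2 : Z ^ 2 + S1 ^ 2 + S2 ^ 2 <= (Z + S1 + S2) ^ 2) by nra.
    eapply Rle_trans; [|apply Rmult_le_compat_l; [lra|exact Y2]].
    generalize (pow2_ge_0 Z) (pow2_ge_0 S1) (Rmult_le_pos _ _ HL0 (pow2_ge_0 Z)) (Rmult_le_pos _ _ HL0 (pow2_ge_0 S1)). lra. }
  rewrite <- (sqrt_pow2 (L2norm a b N (err t))) by apply L2norm_ge_0.
  rewrite <- (sqrt_pow2 (Z + S1 + S2)) by lra.
  rewrite <- sqrt_mult; [now apply sqrt_le_1_alt| |apply pow2_ge_0].
  apply Rmult_le_pos; lra.
Qed.
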